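(* Let $K$ be a non-Galois number field of prime degree $l>3$, and let $L$ be the Galois closure of $K$ over $\mathbb{Q}$, with $\operatorname{Gal}(L/\mathbb{Q})\simeq D_l$, the dihedral group of order $2l$. Let $E$ be the unique quadratic subfield of $L$, and let $Nm_{L/E}:L^{\times}\to E^{\times}$ be the norm map. Let $s_L$ be the number of prime numbers ramified in $L/\mathbb{Q}$. If $L$ is a Pólya field, then: (i) if $L$ is real, then $s_L\le 3$ when the fundamental unit of $E$ belongs to $Nm_{L/E}(U_L)$, and $s_L\le 4$ when it does not; (ii) if $L$ is imaginary, then $s_L\le 2$.
   Context: For a number field $M$ with ring of integers $\mathcal{O}_M$, $U_M=\mathcal{O}_M^\times$. For an integer $q\ge 2$ let $\Pi_q(M)$ be the product of all maximal ideals of $\mathcal{O}_M$ of absolute norm $q$ (an empty product is $\mathcal{O}_M$). The Pólya group $\operatorname{Po}(M)$ is the subgroup of the ideal class group $\operatorname{Cl}(M)$ generated by the classes of all the ideals $\Pi_q(M)$. $M$ is called a Pólya field if $\operatorname{Po}(M)$ is trivial; equivalently, the $\mathcal{O}_M$-module $\operatorname{Int}(\mathcal{O}_M)=\{f\in M[x]: f(\mathcal{O}_M)\subseteq\mathcal{O}_M\}$ has a basis with exactly one member of each degree. For the Galois number field $L$, ''real'' means totally real and ''imaginary'' means totally complex. *)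

(* Defs.v *)
From HB Require Import structures.
From mathcomp Require Import all_boot all_order all_algebra.
From mathcomp Require Import all_fingroup all_solvable all_field.
From mathcomp Require Import finmap.
From mathcomp Require Import boolp classical_sets functions cardinality.

Set Implicit Arguments.
Unset Strict Implicit.
Unset Printing Implicit Defensive.

Import GRing.Theory Num.Theory.

Local Open Scope ring_scope.
Local Open Scope classical_set_scope.
Local Open Scope card_scope.

(* Number fields are subfields M of an ambient finite extension L of rat;
   O_M, its ideals and its fractional ideals are subsets of L. *)

Section RingOfIntegers.
Variables (L : fieldExtType rat) (M : {subfield L}).

Definition ring_of_integers : set L :=
  [set x | x \in M /\ integralOver (intr : int -> L) x].

Definition unit_group : set L :=
  [set u | ring_of_integers u /\
           exists2 v, ring_of_integers v & u * v = 1].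

Definition is_ideal (I : set L) : Prop :=
  [/\ I `<=` ring_of_integers,
      I 0,
      forall x y, I x -> I y -> I (x + y) &
      forall a x, ring_of_integers a -> I x -> I (a * x)].

Definition is_maximal_ideal (P : set L) : Prop :=
  [/\ is_ideal P,
      P <> ring_of_integers &
      forall J, is_ideal J -> P `<=` J -> J = P \/ J = ring_of_integers].

Definition ideal_mul (I J : set L) : set L :=
  [set x | exists s : seq (L * L),
     (forall p, p \in s -> I p.1 /\ J p.2) /\ x = \sum_(p <- s) p.1 * p.2].

Definition quotient_cosets (I : set L) : set (set L) :=
  [set [set x + y | y in I] | x in ring_of_integers].

Definition has_absolute_norm (I : set L) (q : nat) : Prop :=
  quotient_cosets I #= `I_q.

Definition maximal_ideals_of_norm (q : nat) : set (set L) :=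
  [set P | is_maximal_ideal P /\ has_absolute_norm P q].

(* This set is finite for every q, so fset_set enumerates it faithfully. *)
Definition Pi_ideal (q : nat) : set L :=
  \big[ideal_mul/ring_of_integers]_(P <- fset_set (maximal_ideals_of_norm q)) P.

Definition is_fractional_ideal (I : set L) : Prop :=
  [/\ I `<=` [set` M],
      (exists2 x, I x & x != 0),
      forall x y, I x -> I y -> I (x + y),
      forall a x, ring_of_integers a -> I x -> I (a * x) &
      exists d, [/\ ring_of_integers d, d != 0 &
                    forall x, I x -> ring_of_integers (d * x)]].

(* Cl(M) is the group of fractional ideals modulo the principal ones: its
   elements are the cosets {a I | a in M^*}, multiplied elementwise. *)
Definition ideal_class (I : set L) : set (set L) :=
  [set [set a * x | x in I] | a in [set a | a \in M /\ a != 0]].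

Definition class_group : set (set (set L)) :=
  [set ideal_class I | I in is_fractional_ideal].

Definition class_mul (C D : set (set L)) : set (set L) :=
  [set ideal_mul I J | I in C & J in D].

Definition principal_class : set (set L) := ideal_class ring_of_integers.

Definition class_subgroup (H : set (set (set L))) : Prop :=
  [/\ H `<=` class_group,
      H principal_class,
      forall C D, H C -> H D -> H (class_mul C D) &
      forall C D, H C -> class_group D -> class_mul C D = principal_class ->
        H D].

Definition polya_group : set (set (set L)) :=
  smallest class_subgroup
    [set ideal_class (Pi_ideal q) | q in [set q | (2 <= q)%N]].

Definition is_polya_field : Prop := polya_group = [set principal_class].

(* p O_M = P^2 J for some maximal ideal P, i.e. some ramification index
   above p exceeds 1. *)
Definition is_ramified (p : nat) : Prop :=
  exists P J, [/\ is_maximal_ideal P, is_ideal J &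
    [set p%:R * x | x in ring_of_integers] = ideal_mul (ideal_mul P P) J].

Definition ramified_primes : set nat := [set p | prime p /\ is_ramified p].

(* For M real quadratic, where the roots of unity are +1 and -1.  No
   embedding into the reals is chosen, so the four generators
   +e, -e, e^-1, -e^-1 all qualify. *)
Definition is_fundamental_unit (e : L) : Prop :=
  [/\ unit_group e,
      forall n : nat, (0 < n)%N -> e ^+ n != 1 &
      forall u, unit_group u -> exists k : int, u = e ^ k \/ u = - e ^ k].

End RingOfIntegers.

Definition totally_real (L : fieldExtType rat) : Prop :=
  forall (f : {rmorphism L -> algC}) (x : L), f x \is Num.real.

Definition totally_complex (L : fieldExtType rat) : Prop :=
  forall f : {rmorphism L -> algC}, exists x : L, f x \isn't Num.real.

Definition is_galois_closure (L : splittingFieldType rat)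
    (K N : {subfield L}) : Prop :=
  [/\ (K <= N)%VS, galois 1 N &
      forall N' : {subfield L}, (K <= N')%VS -> galois 1 N' -> (N <= N')%VS].

Definition norm_of_units (L : splittingFieldType rat)
    (E : {subfield L}) : set L :=
  [set galNorm E {:L} v | v in unit_group {:L}%AS].

(* Main.v *)
Require Import Defs.
From HB Require Import structures.
From mathcomp Require Import all_boot all_order all_algebra.
From mathcomp Require Import all_fingroup all_solvable all_field.
From mathcomp Require Import finmap.
From mathcomp Require Import boolp classical_sets functions cardinality.
From mathcomp Require Import zify ring.

(** Let G = Gal(L/Q), H = Gal(L/E) = <sigma> and U the units of O_L.  If L is a
    Polya field and p ramifies, the product of the primes above p is generated by
    some w; then g w / w is a unit for every g in G, and w^(2l) = p^k * unit with
    k not divisible by 2l, so k is odd or l does not divide k.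

    Primes with k odd: for subsets S of them the units tau b / b of E, where b is
    the norm to E of the product of the w in S, are distinct modulo units of the
    form tau y / y: an equality would give a rational number whose square has odd
    p-adic valuation for some p.  That quotient has order at most 4 if E is real
    and at most 2 if E is imaginary.

    Primes with l not dividing k: the units sigma w / w lie in the kernel V of
    the norm to E and are independent over F_l modulo (sigma - 1) U, by taking
    norms to Q.  As V is a Z[zeta_l]-module on which sigma - 1 is injective, t
    elements independent modulo (sigma - 1) V have t (l - 1) conjugates that are
    multiplicatively independent.  A pigeonhole argument bounds the number of
    independent units by the number of archimedean places, 2 l or l; this weak
    half of the unit theorem suffices because l > 3.  If e = N(h) with h in U,
    then sigma h / h is one more independent element. *)

Set Implicit Arguments.
Unset Strict Implicit.
Unset Printing Implicit Defensive.

Import Order.TTheory GRing.Theory Num.Theory.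

Local Open Scope ring_scope.

(** * Complex embeddings *)

Section ComplexEmbeddings.
Variables (L : splittingFieldType rat).
Hypothesis galL : galois 1 {:L}%AS.

Lemma galois_primitive_element : exists t : L,
  forall x : L, exists p : {poly rat}, x = (map_poly (GRing.in_alg L) p).[t].
Proof.
exists (separable_generator 1%AS {:L}%AS) => x; apply/Fadjoin1_polyP.
have /and3P[s1L sepL _] := galL.
by rewrite -(eq_adjoin_separable_generator sepL s1L) memvf.
Qed.

(** A primitive element [t] is sent to a complex root [z] of its minimal polynomial. Two polynomials
    with the same value at [t] differ by a multiple of that polynomial, so [p(t) |-> p(z)] is well
    defined. *)
Lemma complex_embedding_exists : inhabited {rmorphism L -> algC}.
Proof.
have [t Dt] := galois_primitive_element.
have [m Dm] : exists m : {poly rat}, minPoly 1%AS t = map_poly (GRing.in_alg L) m.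
  have /polyOver1P[m ->] := minPolyOver 1%AS t.
  by exists m.
have [z mz] : exists z : algC, root (map_poly ratr m) z.
  apply/closed_rootP; rewrite size_map_poly -(size_map_poly (GRing.in_alg L)).
  by rewrite -Dm size_minPoly eqSS -lt0n adjoin_degreeE divn_gt0 ?adim_gt0 ?dimvS ?subv_adjoin.
pose rep x := projT1 (cid (Dt x)).
have repE x : x = (map_poly (GRing.in_alg L) (rep x)).[t].
  by rewrite /rep; case: (cid _).
pose f x : algC := (map_poly ratr (rep x)).[z].
have fE p : f (map_poly (GRing.in_alg L) p).[t] = (map_poly ratr p).[z].
  set x := _.[t]; have := repE x; rewrite {1}/x => /eqP.
  rewrite -subr_eq0 -hornerN -hornerD -rmorphN -rmorphD /= => rt.
  have : minPoly 1%AS t %| map_poly (GRing.in_alg L) (p - rep x).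
    by apply: minPoly_dvdp => //; apply/polyOver1P; exists (p - rep x).
  rewrite Dm dvdp_map -(dvdp_map (@ratr algC)) => /dvdpP[q Dq].
  apply/esym/eqP; rewrite -subr_eq0 -hornerN -hornerD -rmorphN -rmorphD /= Dq.
  by rewrite hornerM (rootP mz) mulr0.
have fD : zmod_morphism f.
  move=> x y; rewrite (repE x) (repE y) -hornerN -hornerD -rmorphB fE /=.
  by rewrite !fE rmorphB hornerD hornerN.
have fM : monoid_morphism f.
  split.
    by have := fE 1; rewrite !rmorph1 !hornerC.
  by move=> x y; rewrite (repE x) (repE y) -hornerM -rmorphM fE /= !fE rmorphM hornerM.
pose fA := GRing.isZmodMorphism.Build _ _ f fD.
pose fMm := GRing.isMonoidMorphism.Build _ _ f fM.
pose fR : {rmorphism L -> algC} := HB.pack f fA fMm.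
by exists; exact: fR.
Qed.

Lemma rmorph_alg_rat (f : {rmorphism L -> algC}) a : f (a%:A) = ratr a.
Proof. by rewrite alg_num_field fmorph_rat. Qed.

(** The conjugate of [f t] is again a root of the minimal polynomial of the primitive element [t].
    That polynomial splits over [L] into factors ['X - c t], so some [c] matches the conjugate at
    [t], hence everywhere. *)
Lemma complex_conjugation_lift (f : {rmorphism L -> algC}) :
  exists c : gal_of {:L}, forall x, (f x)^* = f (c x).
Proof.
have [t Dt] := galois_primitive_element.
have /galois_factors-/(_ (sub1v _))/(_ t (memvf t))[r /= [_ _ Dr]] := galL.
have fP (g : {rmorphism L -> algC}) p :
    g (map_poly (GRing.in_alg L) p).[t] = (map_poly ratr p).[g t].
  rewrite -horner_map -map_poly_comp; congr (_.[_]).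
  by apply: eq_map_poly => a /=; rewrite rmorph_alg_rat.
have /polyOver1P[m Dm] := minPolyOver 1%AS t.
have : root (map_poly ratr m) (f t)^*.
  have Dc : map_poly ratr m = map_poly Num.conj (map_poly (@ratr algC) m).
    by rewrite -map_poly_comp; apply: eq_map_poly => a /=; rewrite fmorph_rat.
  by rewrite Dc fmorph_root /root -fP -Dm (rootP (root_minPoly _ _)) rmorph0.
have -> : map_poly ratr m = map_poly f (minPoly 1%AS t).
  by rewrite Dm -map_poly_comp; apply: eq_map_poly => a /=; rewrite rmorph_alg_rat.
rewrite Dr big_map rmorph_prod /=.
under eq_bigr => c _ do rewrite rmorphB /= map_polyX map_polyC /=.
rewrite -(big_map (fun c : gal_of _ => f (c t)) xpredT (fun b => 'X - b%:P)) root_prod_XsubC.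
case/mapP=> c _ Dc; exists c => x.
have [p ->] := Dt x.
pose fc : {rmorphism L -> algC} := f \o c.
pose cf : {rmorphism L -> algC} := Num.conj \o f.
by rewrite -[RHS]/(fc _) -[LHS]/(cf _) !fP /= Dc.
Qed.

End ComplexEmbeddings.

(** * Integers and units *)

Section Integers.
Variable L : splittingFieldType rat.
Hypothesis galL : galois 1 {:L}%AS.

Notation O := (ring_of_integers {:L}%AS).
Notation U := (unit_group {:L}%AS).
Notation G := ('Gal({:L} / 1))%g.

Lemma natr_eq0_numfield k : (k%:R == 0 :> L) = (k == 0)%N.
Proof. by rewrite -(rmorph_nat (GRing.in_alg L)) fmorph_eq0 pnatr_eq0. Qed.

Lemma intr_inj_numfield : injective (intr : int -> L).
Proof.
move=> x y /eqP; rewrite -!(rmorph_int (GRing.in_alg L)) (inj_eq (fmorph_inj _)).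
by rewrite eqr_int => /eqP.
Qed.

Lemma mem_integers (x : L) : O x <-> integralOver (intr : int -> L) x.
Proof. by split=> [[]|] //; split=> //; apply: memvf. Qed.

Lemma integersB x y : O x -> O y -> O (x - y).
Proof. by rewrite !mem_integers; apply: integral_sub. Qed.

Lemma integersM x y : O x -> O y -> O (x * y).
Proof. by rewrite !mem_integers; apply: integral_mul. Qed.

Lemma integers_nat n : O n%:R.
Proof. by rewrite mem_integers; apply: integral_nat. Qed.

Lemma integers0 : O 0. Proof. exact: (integers_nat 0). Qed.

Lemma integers1 : O 1. Proof. exact: (integers_nat 1). Qed.

Lemma integersN x : O x -> O (- x).
Proof. by rewrite -sub0r; apply: integersB; exact: integers0. Qed.

Lemma integersD x y : O x -> O y -> O (x + y).
Proof. by move=> Ox /integersN Oy; rewrite -[y]opprK; apply: integersB. Qed.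

Lemma integers_int z : O z%:~R.
Proof. by case: z => n; rewrite ?NegzE ?mulrNz; [|apply: integersN]; apply: integers_nat. Qed.

Lemma integers_prod (I : Type) (r : seq I) (P : pred I) F :
  (forall i, P i -> O (F i)) -> O (\prod_(i <- r | P i) F i).
Proof. by move=> OF; apply: big_ind => //; [apply: integers1 | apply: integersM]. Qed.

Lemma integersX x n : O x -> O (x ^+ n).
Proof.
move=> Ox; elim: n => [|n IHn]; first exact: integers1.
by rewrite exprS; apply: integersM.
Qed.

Lemma integers_sum (I : Type) (r : seq I) (P : pred I) F :
  (forall i, P i -> O (F i)) -> O (\sum_(i <- r | P i) F i).
Proof. by move=> OF; apply: big_ind => //; [apply: integers0 | apply: integersD]. Qed.

Lemma integers_gal (g : gal_of {:L}) x : O x -> O (g x).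
Proof.
rewrite !mem_integers => /(integral_rmorph g) [p mp rp]; exists p => //.
by congr (is_true (root _ _)): rp; apply: eq_map_poly => z /=; rewrite rmorph_int.
Qed.

Lemma integers_root x n : (0 < n)%N -> O (x ^+ n) -> O x.
Proof.
move=> n0; rewrite !mem_integers => Oxn.
apply: (@integral_root_monic _ _ _ _ ('X^n - (x ^+ n)%:P)).
- exact: monicXnsubC.
- by rewrite /root !hornerE subrr.
apply/integral_poly => i; rewrite coefB coefXn coefC.
apply: integral_sub; first exact: integral_nat.
by case: ifP => // _; exact: integral0.
Qed.

(** The embedding [f] transports the question to [algC], where rational algebraic integers are known
    to be integers. *)
Lemma rat_integer (f : {rmorphism L -> algC}) a : O (GRing.in_alg L a) -> exists z : int, a = z%:~R.
Proof.
case=> _ [p mp rp].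
have /Cint_rat_Aint : @ratr algC a \in Crat by apply/CratP; exists a.
have /[swap]/[apply] : @ratr algC a \in Aint.
  apply: (@root_monic_Aint (map_poly intr p)); last first.
  - by apply/polyOverP=> i; rewrite coef_map; apply: intr_int.
  - by rewrite monic_map.
  rewrite -(rmorph_alg_rat f) -(fmorph_root f) -map_poly_comp in rp *.
  by congr (is_true (root _ _)): rp; apply: eq_map_poly => z /=; rewrite rmorph_int.
case/intrP=> z /eqP; rewrite -(ratr_int algC) (inj_eq (fmorph_inj _)) => /eqP ->.
by exists z.
Qed.

Lemma gal_fixed_rat x : (forall g, g \in G -> g x = x) -> exists a, x = GRing.in_alg L a.
Proof.
move=> fx; have : x \in 1%VS.
  by rewrite -(galois_fixedField galL) //; apply/fixedFieldP; rewrite ?memvf.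
by case/vlineP=> a ->; exists a.
Qed.

Lemma gal_norm_int x : O x -> exists z : int, galNorm 1 {:L} x = z%:~R.
Proof.
move=> Ox; have [a Da] : exists a, galNorm 1 {:L} x = GRing.in_alg L a.
  have /vlineP[a ->] := mem_galNorm galL (memvf x).
  by exists a.
have [f] := complex_embedding_exists galL.
have [|z Dz] := @rat_integer f a.
  by rewrite -Da; apply: integers_prod => g _; apply: integers_gal.
by exists z; rewrite Da Dz rmorph_int.
Qed.

Lemma unitsP u : U u <-> [/\ u != 0, O u & O u^-1].
Proof.
split=> [[Ou [v Ov uv]]|[u0 Ou Ov]]; last first.
  by split=> //; exists u^-1; rewrite ?divff.
have u0 : u != 0 by apply/eqP=> u0; move/eqP: uv; rewrite u0 mul0r eq_sym oner_eq0.
by split=> //; rewrite -[u^-1]mulr1 -uv mulKf.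
Qed.

Lemma units_neq0 u : U u -> u != 0. Proof. by case/unitsP. Qed.
Lemma units_int u : U u -> O u. Proof. by case/unitsP. Qed.

Lemma units1 : U 1.
Proof. by apply/unitsP; rewrite invr1 oner_eq0; split=> //; exact: integers1. Qed.

Lemma unitsV u : U u -> U u^-1.
Proof. by case/unitsP=> u0 Ou Ov; apply/unitsP; rewrite invrK invr_eq0. Qed.

Lemma unitsM u v : U u -> U v -> U (u * v).
Proof.
case/unitsP=> u0 Ou Ou' /unitsP[v0 Ov Ov'].
by apply/unitsP; rewrite mulf_neq0 // invfM; split=> //; apply: integersM.
Qed.

Lemma unitsN1 : U (-1).
Proof.
apply/unitsP; rewrite invrN1 oppr_eq0 oner_eq0.
by split=> //; apply: integersN; exact: integers1.
Qed.

Lemma units_prod (I : Type) (r : seq I) (P : pred I) F :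
  (forall i, P i -> U (F i)) -> U (\prod_(i <- r | P i) F i).
Proof. by move=> UF; apply: big_ind => //; [apply: units1 | apply: unitsM]. Qed.

Lemma unitsX u n : U u -> U (u ^+ n).
Proof.
move=> Uu; elim: n => [|n IHn]; first exact: units1.
by rewrite exprS; apply: unitsM.
Qed.

Lemma units_exprz u (n : int) : U u -> U (u ^ n).
Proof. by move=> Uu; case: n => n; [|apply: unitsV]; apply: unitsX. Qed.

Lemma units_gal (g : gal_of {:L}) u : U u -> U (g u).
Proof.
case/unitsP=> u0 Ou Ou'; apply/unitsP; rewrite fmorph_eq0 -fmorphV.
by split=> //; apply: integers_gal.
Qed.

Lemma units_root x n : (0 < n)%N -> U (x ^+ n) -> U x.
Proof.
move=> n0 /unitsP[]; rewrite expf_eq0 n0 -exprVn => x0 Ox Ox'.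
by apply/unitsP; split=> //; apply: (@integers_root _ n).
Qed.

End Integers.

(* Infinite descent: by torsion-freeness a relation divisible by p can be divided by p. *)
Lemma relation_descent (V : zmodType) (p : nat) (I : finType) (w : I -> V) :
    (1 < p)%N -> (forall x : V, x *+ p = 0 -> x = 0) ->
    (forall c : I -> int, \sum_i w i *~ c i = 0 -> forall i, (p %| c i)%Z) ->
  forall c : I -> int, \sum_i w i *~ c i = 0 -> forall i, c i = 0.
Proof.
move=> p1 tf wp.
have powp n : forall c : I -> int, \sum_i w i *~ c i = 0 -> forall i, ((p ^ n)%N %| c i)%Z.
  elim: n => [|n IHn] c c0 i; first by rewrite expn0 dvd1z.
  pose d j := (c j %/ p)%Z.
  have cE j : c j = d j * p by rewrite divzK ?wp.
  have d0 : \sum_j w j *~ d j = 0.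
    apply: tf; rewrite -sumrMnl -[RHS]c0; apply: eq_bigr => j _.
    by rewrite cE mulrzA pmulrn.
  by rewrite cE expnSr PoszM dvdz_mul ?IHn.
move=> c c0 i; apply/eqP; rewrite -absz_eq0; apply/eqP.
(* With [n] the absolute value of [c i], the power [p ^ n] exceeds [n], so a multiple of it of size
   [n] is zero. *)
have := powp `|c i|%N c c0 i; rewrite dvdzE absz_nat => /dvdn_leq.
by case: posnP => // _ /(_ isT); rewrite leqNgt ltn_expl.
Qed.

(** * Modules over the cyclotomic integers *)

Lemma iter_is_additive (V : zmodType) (D : {additive V -> V}) k : zmod_morphism (iter k D).
Proof. by move=> x y; elim: k => //= k ->; rewrite raddfB. Qed.

HB.instance Definition _ (V : zmodType) (D : {additive V -> V}) k :=
  GRing.isZmodMorphism.Build V V (iter k D) (iter_is_additive D k).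

(** Binomial expansion of [(1 + D) ^ k]. *)
Lemma iter_add_id (V : zmodType) (D s : {additive V -> V}) (x : V) k :
  (forall y, s y = y + D y) -> iter k s x = \sum_(j < k.+1) iter j D x *+ 'C(k, j).
Proof.
move=> sE; elim: k => [|k IHk]; first by rewrite big_ord1.
rewrite iterS IHk sE [RHS]big_ord_recl /= !bin0.
under [in RHS]eq_bigr => j _ do rewrite /bump /= !add1n binS mulrnDr.
rewrite big_split /= raddf_sum addrA; congr (_ + _); last first.
  by apply: eq_bigr => j _; rewrite raddfMn.
rewrite big_ord_recl /= bin0; congr (_ + _).
by rewrite big_ord_recr /= bin_small // mulr0n addr0.
Qed.

(** The geometric sum of [s = 1 + D] is [((1 + D) ^ k - 1) / D]. For [k = l] this rewrites the norm
    of a cyclic group of order [l] as a polynomial in [D]. *)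
Lemma sum_iter_add_id (V : zmodType) (D s : {additive V -> V}) (x : V) k :
  (forall y, s y = y + D y) ->
  \sum_(j < k) iter j s x = \sum_(j < k) iter j D x *+ 'C(k, j.+1).
Proof.
move=> sE; elim: k => [|k IHk]; first by rewrite !big_ord0.
rewrite big_ord_recr /= IHk (iter_add_id _ _ sE).
under [RHS]eq_bigr => j _ do rewrite binS mulrnDr.
by rewrite big_split /= [X in _ = X + _]big_ord_recr /= bin_small // mulr0n addr0.
Qed.

(* Under the norm relation, V is a module over Z[zeta_l] in which D acts as zeta_l - 1, and
   l is (zeta_l - 1)^(l-1) times a unit. *)
Section CyclotomicModule.
Variables (V : zmodType) (D : {additive V -> V}) (l : nat).
Hypotheses (pr_l : prime l) (D_inj : forall x, D x = 0 -> x = 0).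
Hypothesis norm0 : forall x, \sum_(j < l) iter j D x *+ 'C(l, j.+1) = 0.

Let iterD_inj k x : iter k D x = 0 -> x = 0.
Proof. by elim: k => //= k IHk /D_inj. Qed.

(** In [norm0] the end terms are [x *+ l] and [iter l.-1 D x]; the middle binomial coefficients are
    divisible by the prime [l], and the middle terms add up to [D (z x) *+ l]. *)
Let z x := \sum_(j < l.-2) iter j D x *+ ('C(l, j.+2) %/ l).

Let mull_eq x : x *+ l = - (iter l.-1 D x + D (z x) *+ l).
Proof.
apply/eqP; rewrite -addr_eq0 -[X in _ == X](norm0 x); apply/eqP.
have := prime_gt1 pr_l; rewrite /z.
case: l pr_l => [|[|k]] // pr_k _.
rewrite big_ord_recl big_ord_recr /= bin1 /bump /= add1n binn mulr1n; congr (_ + _).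
rewrite addrC; congr (_ + _); rewrite raddf_sum -sumrMnl; apply: eq_bigr => j _.
rewrite raddfMn -mulrnA divnK ?add1n // prime_dvd_bin //= ltnS.
exact: ltn_ord.
Qed.

(** If [l] kills [x], it also kills [z x], so [mull_eq] leaves [iter l.-1 D x = 0], and [D] is
    injective. *)
Lemma mull_torsion_free (x : V) : x *+ l = 0 -> x = 0.
Proof.
move=> xl; have zl : D (z x) *+ l = 0.
  rewrite -raddfMn /z -sumrMnl big1 ?raddf0 // => j _.
  have -> : iter j D x *+ ('C(l, j.+2) %/ l) *+ l = iter j D (x *+ l) *+ ('C(l, j.+2) %/ l).
    by rewrite raddfMn mulrnAC.
  by rewrite xl raddf0 mul0rn.
apply: (@iterD_inj l.-1); apply/eqP.
by have := mull_eq x; rewrite xl zl addr0 => /esym/eqP; rewrite oppr_eq0.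
Qed.

(** This is the divisibility of [l] by [(zeta_l - 1) ^ (l - 1)]. Each use of [mull_eq] gains one
    factor [D]: if [z x *+ l] lies in the image of [D ^ k], then [x *+ l] lies in that of
    [D ^ (k + 1)]. *)
Lemma mull_iterD k (x : V) : (k < l)%N -> exists y, x *+ l = iter k D y.
Proof.
elim: k x => [|k IHk] x lt; first by exists (x *+ l).
have [y zy] := IHk (z x) (ltnW lt).
have lE : (k.+1 + (l.-1 - k.+1) = l.-1)%N by lia.
exists (- (iter (l.-1 - k.+1) D x + y)).
have iterE : iter k.+1 D (iter (l.-1 - k.+1) D x) = iter l.-1 D x by rewrite -iterD lE.
by rewrite raddfN raddfD [X in - (X + _)]iterE /= -zy mull_eq raddfMn.
Qed.

Variables (t : nat) (v : 'I_t -> V).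
Hypothesis indep : forall (c : 'I_t -> nat) y,
  \sum_i v i *+ c i = D y -> forall i, (l %| c i)%N.

(** Integer coefficients are reduced to their remainders modulo [l]; the discarded multiples of [l]
    lie in the image of [D]. *)
Let indepz (c : 'I_t -> int) y : \sum_i v i *~ c i = D y -> forall i, (l %| c i)%Z.
Proof.
have l0 : l%:Z != 0 by rewrite eqz_nat -lt0n prime_gt0.
move=> cy i; have [y' y'E] := mull_iterD (\sum_j v j *~ (c j %/ l)%Z) (prime_gt1 pr_l).
have := @indep (fun j => `|(c j %% l)%Z|%N) (y - y').
rewrite raddfB -cy /= -[D y']/(iter 1 D y') -y'E -sumrMnl -sumrB.
move=> /(_ _ i) dvd_l; apply/dvdz_mod0P/eqP; rewrite -absz_eq0 -leqn0 leqNgt.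
apply/negP => gt0; have : (l <= `|(c i %% l)%Z|)%N.
  apply: dvdn_leq => //; apply: dvd_l; apply: eq_bigr => j _.
  by rewrite !pmulrn gez0_abs ?modz_ge0 // /modz mulrzBr mulrzA.
rewrite leqNgt -ltz_nat gez0_abs ?modz_ge0 //.
by rewrite ltz_mod // .
Qed.

(** By descent it is enough that [l] divides every coefficient of a relation. This is shown for one
    power of [D] after another, starting from the lowest. *)
Lemma iterD_independent (c : 'I_t * 'I_l.-1 -> int) :
  \sum_(i : 'I_t * 'I_l.-1) iter i.2 D (v i.1) *~ c i = 0 -> forall i, c i = 0.
Proof.
apply: (@relation_descent _ l _ (fun i : 'I_t * 'I_l.-1 => iter i.2 D (v i.1)));
  [exact: prime_gt1 | exact: mull_torsion_free|].
move=> {}c c0.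
(* Modulo the image of [D] only the term [j = 0] survives, so [l] divides [d 0]. That term is then a
   multiple of [l], hence of the form [D ^ (r + 1) y], and can be moved to the right; cancelling one
   [D] leaves a shorter relation. *)
have key r : (r <= l.-1)%N -> forall (d : nat -> 'I_t -> int) x,
    \sum_(j < r) iter j D (\sum_i v i *~ d j i) = iter r D x ->
    forall j, (j < r)%N -> forall i, (l %| d j i)%Z.
  elim: r => [|r IHr] // lt_r d x; rewrite big_ord_recl /= => dx.
  have d0 : forall i, (l %| d 0%N i)%Z.
    apply: (@indepz _ (iter r D x - \sum_(j < r) iter j D (\sum_i v i *~ d j.+1 i))).
    by rewrite raddfB raddf_sum /= -dx addrK.
  have [y yE] : exists y, \sum_i v i *~ d 0%N i = iter r.+1 D y.
    have [|y yE] := @mull_iterD r.+1 (\sum_i v i *~ (d 0%N i %/ l)%Z).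
      by rewrite (leq_ltn_trans lt_r) // prednK ?prime_gt0.
    exists y; rewrite -yE -sumrMnl; apply: eq_bigr => i _.
    by rewrite pmulrn -mulrzA divzK.
  have := IHr (ltnW lt_r) (fun j => d j.+1) (x - y).
  move=> IH [|j] //; rewrite ltnS; apply: IH; apply/eqP; rewrite -subr_eq0; apply/eqP/D_inj.
  rewrite raddfB raddf_sum raddfB /= raddfB -dx yE /= addrAC subrr add0r.
  by apply/eqP; rewrite subr_eq0; apply/eqP/eq_bigr.
(* The value 0 outside the range is only a filler for the indexing by [nat]. *)
move=> [i j]; pose d k i := if insub k is Some j then c (i, j) else 0.
have := key _ (leqnn _) d 0; rewrite raddf0 => /(_ _ j (ltn_ord j) i).
rewrite /d valK; apply; rewrite -[RHS]c0.
transitivity (\sum_(m < t) \sum_(k < l.-1) iter k D (v m) *~ c (m, k)); last first.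
  by rewrite pair_bigA; apply: eq_bigr => -[].
rewrite exchange_big; apply: eq_bigr => k _; rewrite raddf_sum; apply: eq_bigr => m _.
by rewrite valK raddfMz.
Qed.

End CyclotomicModule.

Local Open Scope card_scope.
Local Open Scope classical_set_scope.

(** * Residue classes modulo an ideal *)

Lemma card_finType (T : finType) : [set: T] #= `I_#|T|.
Proof.
have -> : [set: T] = [set` [fset x in enum T]%fset].
  by apply/seteqP; split=> x //= _; rewrite inE mem_enum.
apply/card_eq_fsetP; rewrite card_fseq undup_id ?enum_uniq //.
by rewrite -cardE.
Qed.

Section Ideals.
Variable L : splittingFieldType rat.
Notation O := (ring_of_integers {:L}%AS).

Variable I : set L.
Hypothesis idI : is_ideal {:L}%AS I.

Lemma ideal_int x : I x -> O x. Proof. by case: idI => IO _ _ _ /IO. Qed.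
Lemma mem_ideal0 : I 0. Proof. by case: idI. Qed.
Lemma mem_idealD x y : I x -> I y -> I (x + y). Proof. by case: idI => _ _ ID _; apply: ID. Qed.
Lemma mem_idealMl a x : O a -> I x -> I (a * x). Proof. by case: idI => _ _ _; apply. Qed.
Lemma mem_idealMr a x : O a -> I x -> I (x * a). Proof. by rewrite mulrC; apply: mem_idealMl. Qed.

Lemma mem_idealN x : I x -> I (- x).
Proof. by rewrite -mulN1r; apply: mem_idealMl; apply: integersN; apply: integers1. Qed.

Lemma mem_idealB x y : I x -> I y -> I (x - y).
Proof. by move=> Ix /mem_idealN; apply: mem_idealD. Qed.

Lemma ideal_sum (J : Type) (r : seq J) (P : pred J) F :
  (forall i, P i -> I (F i)) -> I (\sum_(i <- r | P i) F i).
Proof. by move=> IF; apply: big_ind => //; [apply: mem_ideal0 | apply: mem_idealD]. Qed.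

Lemma eq_coset x y : [set x + z | z in I] = [set y + z | z in I] <-> I (x - y).
Proof.
split=> [Exy|Ixy].
  have : [set x + z | z in I] x by exists 0; [apply: mem_ideal0 | rewrite addr0].
  by rewrite Exy => -[z Iz <-]; rewrite addrC addKr.
apply/seteqP; split=> _ [z Iz <-].
  by exists (x - y + z); [apply: mem_idealD | ring].
by exists (z - (x - y)); [apply: mem_idealB | ring].
Qed.

Section Quotient.
Variable p : nat.
Hypotheses (pr_p : prime p) (Ip : I p%:R).

(** Linear independence of the classes in [O / I] over the field with [p] elements. *)
Definition independent_mod (s : seq L) :=
  (forall x, x \in s -> O x) /\
  forall c : nat -> int, I (\sum_(i < size s) s`_i *~ c i) ->
  forall i, (i < size s)%N -> (p %| c i)%Z.

(** Such a list is even free over the rationals: a rational relation becomes integral after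
    multiplication by a common denominator, its value 0 lies in [I], so [p] divides all
    coefficients, and descent makes them vanish. *)
Lemma independent_mod_size s : independent_mod s -> (size s <= \dim {:L})%N.
Proof.
case=> _ ind_s; suffices /eqP <- : free s by apply: dimvS; apply: subvf.
rewrite -[s]in_tupleE; apply/freeP => k k0 i.
have [/= d [d0 dk]] : exists d : int, d != 0 /\ forall j, exists z : int, k j * d%:~R = z%:~R.
  exists (\prod_j denq (k j)); split=> [|j]; first by apply/prodf_neq0 => j _.
  exists (numq (k j) * \prod_(m | m != j) denq (k m)).
  by rewrite (bigD1 j) //= !rmorphM /= mulrA numqE.
have [c cE] := choice dk.
suffices c0 : c i = 0.
  apply/eqP; have /eqP := cE i; rewrite c0 mulf_eq0 => /orP[//|].
  by rewrite intr_eq0 (negPf d0).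
refine (@relation_descent _ p _ (fun i : 'I_(size s) => s`_i) _ _ _ c _ i).
- exact: prime_gt1.
- move=> x /eqP; rewrite -mulr_natr mulf_eq0 natr_eq0_numfield => /orP[/eqP //|].
  by rewrite -leqn0 leqNgt prime_gt0.
- move=> b b0 {}i; pose b' j := if insub j is Some i then b i else 0.
  have b'E (j : 'I_(size s)) : b' j = b j by rewrite /b' valK.
  rewrite -b'E; apply: ind_s => //.
  by under eq_bigr do rewrite b'E; rewrite b0; apply: mem_ideal0.
transitivity ((\sum_i k i *: s`_i) *~ d); last by rewrite k0 mul0rz.
rewrite mulrz_suml; apply: eq_bigr => j _.
by rewrite -scaler_int -(scaler_int d) scalerA mulrC cE.
Qed.

Lemma independent_mod_maximal : exists s, independent_mod s /\
  forall x, O x -> ~ independent_mod (rcons s x).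
Proof.
have ex : exists n, `[<exists s, independent_mod s /\ size s = n>].
  by exists 0%N; apply/asboolP; exists [::].
have ub n : `[<exists s, independent_mod s /\ size s = n>] -> (n <= \dim {:L})%N.
  by move=> /asboolP[s [ind_s <-]]; apply: independent_mod_size.
case: (ex_maxnP ex ub) => n /asboolP[s [ind_s <-]] max_s.
exists s; split=> // x _ ind_sx.
have /max_s : `[<exists t, independent_mod t /\ size t = size (rcons s x)>].
  by apply/asboolP; exists (rcons s x).
by rewrite size_rcons ltnn.
Qed.

(** A maximal independent list is a basis of [O / I] over the field with [p] elements; the
    representatives are its combinations with digits below [p]. *)
Lemma quotient_representatives : exists m (phi : {ffun 'I_m -> 'I_p} -> L),
  [/\ forall a, O (phi a), forall a b, I (phi a - phi b) -> a = b &
      forall x, O x -> exists a, I (x - phi a)].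
Proof.
have p0 : (0 < p)%N := prime_gt0 pr_p.
have [s [[sO ind_s] max_s]] := independent_mod_maximal.
exists (size s); pose phi (a : {ffun 'I_(size s) -> 'I_p}) : L := \sum_(i < size s) s`_i *+ a i.
have phiO a : O (phi a).
  by apply: integers_sum => i _; rewrite -mulr_natr; apply: integersM;
    [apply/sO/mem_nth | apply: integers_nat].
have phi_inj a b : I (phi a - phi b) -> a = b.
  rewrite -sumrB => Iab; apply/ffunP => i; apply/val_inj/eqP.
  pose c j := if insub j is Some i then (a i : nat)%:Z - (b i : nat)%:Z else 0.
  have cE (j : 'I_(size s)) : c j = (a j : nat)%:Z - (b j : nat)%:Z by rewrite /c valK.
  have := ind_s c; under eq_bigr => j _ do rewrite cE mulrzBr.
  move=> /(_ Iab i (ltn_ord i)); rewrite cE -eqz_mod_dvd.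
  by rewrite !modz_nat eqz_nat !modn_small ?ltn_ord.
exists phi; split=> // [x] Ox.
(* By maximality, adjoining [x] creates a relation modulo [I] with a coefficient not divisible by
   [p]. *)
have /existsNP[c /not_implyP[Ic /existsNP[i /not_implyP[ltis ndvd]]]] :
    ~ forall c : nat -> int,
      I (\sum_(i < size (rcons s x)) (rcons s x)`_i *~ c i) ->
      forall i, (i < size (rcons s x))%N -> (p %| c i)%Z.
  move=> ind_sx; apply: (max_s x Ox); split=> // y; rewrite mem_rcons inE.
  by case/predU1P=> [-> //|]; apply: sO.
have IpM (y : L) (z : int) : O y -> (p %| z)%Z -> I (y *~ z).
  move=> Oy /dvdzP[d ->]; rewrite mulrzA -pmulrn -mulr_natr; apply: mem_idealMl => //.
  by rewrite -mulrzr; apply: integersM => //; apply: integers_int.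
have sOn j : O s`_j.
  by have [lt|ge] := ltnP j (size s); [apply/sO/mem_nth | rewrite nth_default //; apply: integers0].
rewrite size_rcons in Ic ltis.
have {}Ic : I (x *~ c (size s) + \sum_(j < size s) s`_j *~ c j).
  move: Ic; rewrite big_ord_recr /= nth_rcons ltnn eqxx addrC.
  by under eq_bigr => j _ do rewrite nth_rcons ltn_ord.
(* Otherwise the term of [x] lies in [I], and what remains contradicts the independence of [s]. *)
have cs : ~~ (p %| c (size s))%Z.
  apply/negP => dvd_cs; apply: ndvd; move: ltis; rewrite ltnS leq_eqVlt.
  case/predU1P=> [-> //|]; apply: ind_s.
  by rewrite -[X in I X](addKr (x *~ c (size s))) addrC; apply: mem_idealB => //; apply: IpM.
have [[u v] /= uv] : exists u : int * int, (u.1 * c (size s) + u.2 * p = 1)%R.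
  have : coprimez (c (size s)) p by rewrite coprimez_sym coprimezE prime_coprime.
  by case/coprimezP => u Du; exists u.
(* Multiplying the relation by the inverse [u] of the coefficient of [x] modulo [p] solves it for
   [x]; the digits are the remainders of [- u * c j]. *)
pose a := [ffun j : 'I_(size s) => Ordinal (ltn_pmod `|((- u * c j) %% p)%Z|%N p0)].
exists a; have aE j : exists z : int, (a j : nat)%:Z = - u * c j + z * p.
  exists (- ((- u * c j) %/ p)%Z); rewrite ffunE /=.
  have pZ0 : p%:Z != 0 by rewrite eqz_nat -lt0n.
  rewrite -modz_nat gez0_abs ?modz_ge0 // modz_mod.
  by rewrite {2}(divz_eq (- u * c j) p); ring.
have -> : x - phi a = (x *~ c (size s) + \sum_(j < size s) s`_j *~ c j) *~ u + x *~ (v * p)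
    - \sum_(j < size s) s`_j *~ ((a j : nat)%:Z + u * c j).
  have xE : x = x *~ c (size s) *~ u + x *~ (v * p).
    by rewrite -mulrzA -mulrzDr [c _ * u]mulrC uv.
  set S := \sum_(j < size s) s`_j *~ c j; set T := \sum_(j < size s) _.
  have phiE : phi a = T - S *~ u.
    rewrite /S /T mulrz_suml -sumrB; apply: eq_bigr => j _.
    by rewrite mulrzDr -mulrzA pmulrn [c j * u]mulrC addrK.
  by rewrite phiE mulrzDl [x in LHS]xE; ring.
apply: mem_idealB => //; [apply: mem_idealD => // | apply: ideal_sum => // j _].
- by rewrite -[_ *~ u]mulrzr; apply: mem_idealMr => //; apply: integers_int.
- by apply: IpM => //; rewrite dvdz_mull.
- by apply: IpM => //; have [z ->] := aE j; rewrite mulNr addrAC addNr add0r dvdz_mull.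
Qed.

Lemma quotient_card : exists m, quotient_cosets {:L}%AS I #= `I_(p ^ m).
Proof.
have [m [phi [phiO phi_inj phi_surj]]] := quotient_representatives.
exists m; have -> : quotient_cosets {:L}%AS I =
    (fun a => [set phi a + z | z in I]) @` [set: {ffun 'I_m -> 'I_p}].
  apply/seteqP; split=> [_ [x Ox <-]|_ [a _ <-]]; last by exists (phi a).
  have [a Ia] := phi_surj x Ox; exists a => //.
  by apply/eq_coset; rewrite -opprB; apply: mem_idealN.
have -> : (p ^ m)%N = #|{ffun 'I_(m) -> 'I_p}|.
  by rewrite card_ffun !card_ord.
apply: card_eq_trans (card_finType _).
by apply: inj_card_eq => a b _ _ /eq_coset; apply: phi_inj.
Qed.

End Quotient.

End Ideals.

(** * Maximal ideals and the ideals Pi_q *)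

Section MaximalIdeals.
Variable L : splittingFieldType rat.
Notation O := (ring_of_integers {:L}%AS).
Notation maximal := (is_maximal_ideal {:L}%AS).
Notation ideal := (is_ideal {:L}%AS).

Lemma maximal_ideal P : maximal P -> ideal P. Proof. by case. Qed.

Lemma maximal_proper P : maximal P -> ~ P 1.
Proof.
case=> idP PO _ P1; apply: PO; apply/seteqP; split=> x; first exact: ideal_int.
by move=> Ox; rewrite -[x]mulr1; apply: mem_idealMl.
Qed.

Lemma principal_ideal k : ideal [set k%:R * x | x in O].
Proof.
split=> [_ [x Ox <-] || _ _ [x Ox <-] [y Oy <-]|a _ Oa [x Ox <-]].
- by apply: integersM => //; apply: integers_nat.
- by exists 0; [apply: integers0 | rewrite mulr0].
- by exists (x + y); [apply: integersD | rewrite mulrDr].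
- by exists (a * x); [apply: integersM | rewrite mulrCA].
Qed.

(** The ideal [P + O y] is strictly larger than [P], so it contains 1. *)
Lemma maximal_bezout P y : maximal P -> O y -> ~ P y ->
  exists b, O b /\ P (1 - b * y).
Proof.
case=> idP _ maxP Oy Py.
pose J := [set x | exists a b, [/\ P a, O b & x = a + b * y]].
have idJ : ideal J.
  split=> [_ [a [b [Pa Ob ->]]] || _ _ [a [b [Pa Ob ->]]] [a' [b' [Pa' Ob' ->]]]
          | c _ Oc [a [b [Pa Ob ->]]]].
  - by apply: integersD; [apply: ideal_int Pa | apply: integersM].
  - by exists 0, 0; rewrite mul0r addr0; split=> //; [apply: mem_ideal0 | apply: integers0].
  - exists (a + a'), (b + b'); split; [exact: mem_idealD | exact: integersD | ring].
  - exists (c * a), (c * b); split; [exact: mem_idealMl | exact: integersM | ring].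
have [|JP|JO] := maxP J idJ.
- by move=> a Pa; exists a, 0; rewrite mul0r addr0; split=> //; apply: integers0.
- case: Py; rewrite -JP; exists 0, 1; rewrite mul1r add0r.
  by split=> //; [apply: mem_ideal0 | apply: integers1].
have [a [b [Pa Ob ab]]] : J 1 by rewrite JO; apply: integers1.
by exists b; split=> //; rewrite ab addrK.
Qed.

Lemma maximal_mul P x y : maximal P -> O x -> O y -> P (x * y) -> P x \/ P y.
Proof.
move=> maxP Ox Oy Pxy; have idP := maximal_ideal maxP.
case: (pselect (P y)) => [|Py]; [by right | left].
have [b [Ob Pb]] := maximal_bezout maxP Oy Py.
have -> : x = x * (1 - b * y) + b * (x * y) by ring.
by apply: mem_idealD => //; apply: mem_idealMl.
Qed.

Lemma maximal_prime_nat P n : maximal P -> (0 < n)%N -> P n%:R ->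
  exists2 p, prime p & P p%:R.
Proof.
move=> maxP; elim/ltn_ind: n => n IHn n0 Pn.
have [n1|n1] := leqP n 1.
  have n_eq1 : n = 1%N by apply/eqP; rewrite eqn_leq n1 n0.
  by case: (maximal_proper maxP); rewrite n_eq1 in Pn.
have pr_n := pdiv_prime n1; move: Pn; rewrite -{1}(divnK (pdiv_dvd n)) natrM => Pn.
have [|||Pm] := maximal_mul maxP _ _ Pn; try exact: integers_nat.
  by apply: IHn; rewrite ?ltn_Pdiv ?prime_gt1 // divn_gt0 ?pdiv_gt0 // dvdn_leq ?pdiv_dvd.
by exists (pdiv n).
Qed.

(** If [P] contained no positive integer, the natural numbers would be pairwise incongruent modulo
    [P], against the finiteness of the quotient. *)
Lemma maximal_finite_norm_prime P q : maximal P -> has_absolute_norm {:L}%AS P q ->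
  exists2 p, prime p & P p%:R.
Proof.
move=> maxP Pq; have idP := maximal_ideal maxP.
suffices [n n0 Pn] : exists2 n, (0 < n)%N & P n%:R by apply: maximal_prime_nat Pn.
apply: contrapT => noP.
have finQ : finite_set (quotient_cosets {:L}%AS P) by apply/finite_setP; exists q.
have : [set: nat] #<= quotient_cosets {:L}%AS P.
  pose h (n : nat) := [set (n%:R : L) + y | y in P].
  have hinj : {in [set: nat] &, injective h}.
    move=> m n _ _ /(eq_coset idP); wlog le_mn : m n / (n <= m)%N.
      move=> wl; case/orP: (leq_total n m) => [/wl //|le] Pmn.
      by apply/esym/wl => //; rewrite -opprB; apply: mem_idealN.
    rewrite -natrB // => Pmn; apply/eqP; rewrite eqn_leq le_mn andbT -subn_eq0 -leqn0 leqNgt.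
    by apply/negP => gt0; apply: noP; exists (m - n)%N.
  apply/card_subP; exists (h @` [set: nat]); first exact: inj_card_eq.
  by move=> _ [n _ <-]; exists n%:R => //; apply: integers_nat.
by move/infiniteP.
Qed.

Lemma norm_prime_power P p q : maximal P -> prime p -> P p%:R ->
  has_absolute_norm {:L}%AS P q -> exists m, q = (p ^ m)%N.
Proof.
move=> maxP pr_p Pp Pq; have [m cm] := quotient_card (maximal_ideal maxP) pr_p Pp.
by exists m; apply/card_eq_II; apply: card_eq_trans cm; apply: card_esym.
Qed.

(** The norm is a power of the residue characteristic, and [q > 1] is a power of only one prime. *)
Lemma same_norm_prime P P' p q : maximal P -> maximal P' -> prime p -> (1 < q)%N ->
  has_absolute_norm {:L}%AS P q -> has_absolute_norm {:L}%AS P' q ->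
  P p%:R -> P' p%:R.
Proof.
move=> maxP maxP' pr_p q1 Pq P'q Pp.
have [p' pr_p' P'p'] := maximal_finite_norm_prime maxP' P'q.
have [m qm] := norm_prime_power maxP pr_p Pp Pq.
have [m' qm'] := norm_prime_power maxP' pr_p' P'p' P'q.
suffices -> : p = p' by [].
have m0 : (0 < m)%N by rewrite lt0n; apply: contraTneq q1 => m0; rewrite qm m0.
have : (p %| p' ^ m')%N by rewrite -qm' qm dvdn_exp.
by rewrite Euclid_dvdX // dvdn_prime2 // => /andP[/eqP].
Qed.

(** Such an ideal is a union of classes modulo [p O], of which there are finitely many. *)
Lemma finite_ideals_over_prime p : prime p -> finite_set [set J | ideal J /\ J p%:R].
Proof.
move=> pr_p; pose I := [set p%:R * x | x in O].
have idI : ideal I := principal_ideal p.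
have Ip : I p%:R by exists 1; [apply: integers1 | rewrite mulr1].
have [m [phi [phiO _ phi_surj]]] := quotient_representatives idI pr_p Ip.
pose h (J : set L) := [set a | `[<J (phi a)>]]%SET.
have h_inj : {in [set J | ideal J /\ J p%:R] &, injective h}.
  suffices hS J J' : ideal J -> J p%:R -> ideal J' -> J' p%:R -> h J = h J' -> J `<=` J'.
    move=> J J' /set_mem[idJ Jp] /set_mem[idJ' J'p] hJ.
    by apply/seteqP; split; apply: hS.
  move=> idJ Jp idJ' J'p /setP hJ x Jx.
  have [a [y Oy xa]] := phi_surj x (ideal_int idJ Jx).
  have Jphi : J (phi a).
    have -> : phi a = x - p%:R * y by rewrite xa opprB addrC subrK.
    by apply: mem_idealB => //; apply: mem_idealMr.
  have := hJ a; rewrite !inE; move/asboolP: (Jphi) => -> /esym/asboolP J'phi.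
  have -> : x = phi a + p%:R * y by rewrite xa addrC subrK.
  by apply: mem_idealD => //; apply: mem_idealMr.
apply: (@card_le_finite _ _ _ [set: {set {ffun 'I_m -> 'I_p}}]); last exact: finite_finset.
by rewrite -(card_le_eql (inj_card_eq h_inj)); apply: subset_card_le.
Qed.

Lemma mem_ideal_mul (I J : set L) a b : I a -> J b -> ideal_mul I J (a * b).
Proof.
by move=> Ia Jb; exists [:: (a, b)]; split=> [c|]; rewrite ?big_seq1 // inE => /eqP ->.
Qed.

Lemma ideal_mulD (I J : set L) x y : ideal_mul I J x -> ideal_mul I J y -> ideal_mul I J (x + y).
Proof.
move=> [s [sP ->]] [t [tP ->]]; exists (s ++ t); rewrite big_cat; split=> // c.
by rewrite mem_cat => /orP[/sP|/tP].
Qed.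

Lemma ideal_mul_ind (I J T : set L) :
    T 0 -> (forall x y, T x -> T y -> T (x + y)) ->
    (forall a b, I a -> J b -> T (a * b)) -> ideal_mul I J `<=` T.
Proof.
move=> T0 TD TM _ [s [sP ->]]; rewrite big_seq.
by apply: big_ind => // c /sP[]; apply: TM.
Qed.

(** For each [Q] in [s] some [c] in [Q] lies outside [P]; with an inverse [d] modulo [P], the
    product [d * c] lies in [Q] and is 1 modulo [P]. The witness is the product of these
    elements. *)
Lemma comaximal_witness P (s : seq (set L)) : maximal P -> P \notin s ->
    (forall Q, Q \in s -> maximal Q) ->
  exists b, [/\ O b, forall Q, Q \in s -> Q b & P (1 - b)].
Proof.
move=> maxP; have idP := maximal_ideal maxP.
elim: s => [|Q s IHs].
  by exists 1; rewrite subrr; split=> //; [apply: integers1 | apply: mem_ideal0].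
rewrite inE negb_or => /andP[/eqP PQ Ps] max_s.
have [|b [Ob sb Pb]] := IHs Ps; first by move=> R sR; apply: max_s; rewrite inE sR orbT.
have maxQ : maximal Q by apply: max_s; rewrite inE eqxx.
have [c Qc Pc] : exists2 c, Q c & ~ P c.
  apply: contrapT => nQP; case: (maxQ) => _ _ /(_ P idP)[|//|PO].
    by move=> c Qc; apply: contrapT => Pc; apply: nQP; exists c.
  by case: maxP.
have Oc := ideal_int (maximal_ideal maxQ) Qc.
have [d [Od Pd]] := maximal_bezout maxP Oc Pc.
exists (b * (d * c)); split.
- by apply: integersM => //; apply: integersM.
- move=> R; rewrite inE => /predU1P[->|sR].
    have idQ := maximal_ideal maxQ.
    by apply: mem_idealMl => //; apply: mem_idealMl.
  apply: mem_idealMr; [|exact: integersM|exact: sb].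
  by apply/maximal_ideal/max_s; rewrite inE sR orbT.
have -> : 1 - b * (d * c) = (1 - b) + b * (1 - d * c) by ring.
by apply: mem_idealD => //; apply: mem_idealMl.
Qed.

(** For distinct maximal ideals the product is the intersection: if [b] lies in all ideals of [s]
    and is 1 modulo [P], then [x = (1 - b) * x + x * b] exhibits an element of the intersection as a
    sum of products. *)
Lemma big_ideal_mul_maximal (s : seq (set L)) : uniq s -> (forall Q, Q \in s -> maximal Q) ->
  \big[@ideal_mul L/O]_(P <- s) P = [set x | O x /\ forall P, P \in s -> P x].
Proof.
elim: s => [|P s IHs] /=; first by rewrite big_nil => _ _; apply/seteqP; split=> [x|x []].
case/andP=> Ps Us max_s; rewrite big_cons IHs //; last first.
  by move=> R sR; apply: max_s; rewrite inE sR orbT.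
have maxP : maximal P by apply: max_s; rewrite inE eqxx.
have idP := maximal_ideal maxP.
have max_s' Q : Q \in s -> maximal Q by move=> sR; apply: max_s; rewrite inE sR orbT.
apply/seteqP; split.
  apply: ideal_mul_ind.
  - split=> [|Q /max_s maxQ]; [exact: integers0 | exact: mem_ideal0 (maximal_ideal maxQ)].
  - move=> x y [Ox sx] [Oy sy]; split=> [|Q sQ]; first exact: integersD.
    by apply: (mem_idealD (maximal_ideal (max_s Q sQ))); [apply: sx | apply: sy].
  move=> a b Pa [Ob sb]; have Oa := ideal_int idP Pa; split=> [|Q]; first exact: integersM.
  rewrite inE => /predU1P[->|sQ]; first exact: mem_idealMr.
  by apply: mem_idealMl => //; [apply/maximal_ideal/max_s' | apply: sb].
move=> x [Ox sx]; have [b [Ob sb Pb]] := comaximal_witness maxP Ps max_s'.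
have Px : P x by apply: sx; rewrite inE eqxx.
have -> : x = (1 - b) * x + x * b by ring.
apply: ideal_mulD; apply: mem_ideal_mul => //.
  by split=> // Q sQ; apply: sx; rewrite inE sQ orbT.
Qed.

Lemma finite_maximal_ideals_of_norm q : (1 < q)%N ->
  finite_set (maximal_ideals_of_norm {:L}%AS q).
Proof.
move=> q1; have [[P [maxP Pq]]|noP] := pselect (exists P, maximal_ideals_of_norm {:L}%AS q P).
  have [p pr_p Pp] := maximal_finite_norm_prime maxP Pq.
  apply: sub_finite_set (finite_ideals_over_prime pr_p) => Q [maxQ Qq].
  split; first exact: maximal_ideal.
  exact: (same_norm_prime maxP maxQ pr_p q1 Pq Qq Pp).
have -> : maximal_ideals_of_norm {:L}%AS q = set0.
  by apply/seteqP; split=> Q // Qq; case: noP; exists Q.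
exact: finite_set0.
Qed.

Lemma Pi_ideal_cap q : (1 < q)%N -> Pi_ideal {:L}%AS q =
  [set x | O x /\ forall P, maximal_ideals_of_norm {:L}%AS q P -> P x].
Proof.
move=> q1; have finq := finite_maximal_ideals_of_norm q1.
have memq P : (P \in fset_set (maximal_ideals_of_norm {:L}%AS q)) =
    (P \in maximal_ideals_of_norm {:L}%AS q) by rewrite in_fset_set.
rewrite /Pi_ideal big_ideal_mul_maximal ?fset_uniq //; last first.
  by move=> Q; rewrite memq => /set_mem[].
apply/seteqP; split=> x [Ox Px]; split=> // P.
  by move=> /mem_set Pq; apply: Px; rewrite memq.
by rewrite memq => /set_mem; apply: Px.
Qed.

End MaximalIdeals.

(** * Ramified primes in a Polya field *)

Section RamifiedPrimes.
Variable L : splittingFieldType rat.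
Hypothesis galL : galois 1 {:L}%AS.
Notation O := (ring_of_integers {:L}%AS).
Notation U := (unit_group {:L}%AS).
Notation maximal := (is_maximal_ideal {:L}%AS).
Notation ideal := (is_ideal {:L}%AS).
Notation n := #|'Gal({:L} / 1)%g|.

Lemma galVK (g : gal_of {:L}) : cancel g (g^-1)%g.
Proof. by move=> x; rewrite -galM ?memvf // mulgV gal_id. Qed.

Lemma galKV (g : gal_of {:L}) : cancel (g^-1)%g g.
Proof. by move=> x; rewrite -galM ?memvf // mulVg gal_id. Qed.

Lemma ideal_gal_preimage (g : gal_of {:L}) I : ideal I -> ideal [set x | I (g x)].
Proof.
move=> idI; split=> [x /= Igx|| x y /= Ix Iy|a x Oa /= Ix].
- by rewrite -[x](galVK g); apply/integers_gal/(ideal_int idI).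
- by rewrite /= rmorph0; apply: mem_ideal0.
- by rewrite rmorphD; apply: mem_idealD.
by rewrite rmorphM; apply: mem_idealMl => //; apply: integers_gal.
Qed.

Lemma maximal_gal_preimage (g : gal_of {:L}) P q :
  maximal_ideals_of_norm {:L}%AS q P ->
  maximal_ideals_of_norm {:L}%AS q [set x | P (g x)].
Proof.
case=> maxP Pq; have idP := maximal_ideal maxP; split.
  split=> [||J idJ sPJ]; first exact: ideal_gal_preimage.
    move/seteqP=> [_ /(_ 1 (integers1 _))] /=; rewrite rmorph1; exact: maximal_proper.
  case: maxP => _ _ /(_ _ (ideal_gal_preimage (g^-1)%g idJ))[x Px||].
  - by apply: sPJ; rewrite /= galKV.
  - by move=> JP; left; apply/seteqP; split=> x; rewrite -JP /= galVK.
  - move=> JO; right; apply/seteqP; split=> x; first exact: ideal_int.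
    by move/(integers_gal g); rewrite -JO /= galVK.
apply: card_eq_trans Pq.
have -> : quotient_cosets {:L}%AS [set x | P (g x)] =
    (fun C => (g^-1)%g @` C) @` quotient_cosets {:L}%AS P.
  have imE x : (g^-1)%g @` [set g x + y | y in P] = [set x + y | y in [set x | P (g x)]].
    apply/seteqP; split=> [_ [_ [y Py <-] <-]|_ [y Py <-]].
      by exists ((g^-1)%g y); [rewrite /= galKV | rewrite [RHS]rmorphD /= galVK].
    by exists (g (x + y)); rewrite ?galVK //; exists (g y); rewrite // rmorphD.
  apply/seteqP; split=> [_ [x Ox <-]|_ [_ [x Ox <-] <-]].
    by exists [set g x + y | y in P] => //; exists (g x) => //; apply: integers_gal.
  exists ((g^-1)%g x); first exact: integers_gal.
  by rewrite -imE galKV.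
apply: inj_card_eq => C D _ _ /= CD.
have gK (A : set L) : g @` ((g^-1)%g @` A) = A.
  apply/seteqP; split=> [_ [_ [x Ax <-] <-]|x Ax]; first by rewrite galKV.
  by exists ((g^-1)%g x); rewrite ?galKV //; exists x.
by rewrite -[C]gK CD gK.
Qed.

Lemma polya_Pi_principal q : is_polya_field {:L}%AS -> (1 < q)%N ->
  exists2 w, w != 0 & Pi_ideal {:L}%AS q = [set w * x | x in O].
Proof.
move=> polyaL q1.
have cl1 : ideal_class {:L}%AS (Pi_ideal {:L}%AS q) = principal_class {:L}%AS.
  suffices : polya_group {:L}%AS (ideal_class {:L}%AS (Pi_ideal {:L}%AS q)).
    by rewrite polyaL.
  by apply: sub_gen_smallest; exists q.
have : principal_class {:L}%AS O.
  exists 1; first by split; [apply: memvf | apply: oner_neq0].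
  by apply/seteqP; split=> [_ [x Ox <-]|x Ox]; [rewrite mul1r | exists x; rewrite ?mul1r].
rewrite -cl1 => -[a [_ a0] aPi]; exists a^-1; first by rewrite invr_eq0.
apply/seteqP; split=> [x Pix|_ [x Ox <-]].
  by exists (a * x); rewrite ?mulKf // -aPi; exists x.
by move: Ox; rewrite -aPi => -[y Piy <-]; rewrite mulKf.
Qed.

(* If pi were divisible by p then P = P^2, so that pi would lie in pi * P. *)
Lemma ramified_generator p :
    is_polya_field {:L}%AS -> prime p -> is_ramified {:L}%AS p ->
  exists w k u, [/\ w != 0, forall g : gal_of {:L}, U (g w / w), U u,
    w ^+ n = p%:R ^+ k * u & ~~ (n %| k)%N].
Proof.
move=> polyaL pr_p [P [J [maxP idJ pE]]].
have idP := maximal_ideal maxP.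
have P2 x : O x -> ideal_mul P P (p%:R * x).
  move=> Ox; have : [set p%:R * x | x in O] (p%:R * x) by exists x.
  rewrite pE; move: (p%:R * x); apply: ideal_mul_ind.
  - by exists [::]; rewrite big_nil.
  - exact: ideal_mulD.
  move=> a b Pa Jb; move: a Pa; apply: ideal_mul_ind.
  - by rewrite mul0r; exists [::]; rewrite big_nil.
  - by move=> x1 y1; rewrite mulrDl; apply: ideal_mulD.
  move=> a1 a2 Pa1 Pa2; rewrite -mulrA; apply: mem_ideal_mul => //.
  by apply: mem_idealMr => //; apply: ideal_int Jb.
have PP x : ideal_mul P P x -> P x.
  move: x; apply: ideal_mul_ind; first exact: mem_ideal0.
    by move=> x y; apply: mem_idealD.
  by move=> a b Pa Pb; apply: mem_idealMl => //; apply: ideal_int Pa.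
have Pp : P p%:R by rewrite -[p%:R]mulr1; apply/PP/P2/integers1.
have [q q1 Pq] : exists2 q, (1 < q)%N & has_absolute_norm {:L}%AS P q.
  have [m cm] := quotient_card idP pr_p Pp; exists (p ^ m)%N => //.
  (* The classes of 0 and 1 are distinct, so the norm of [P] exceeds 1. *)
  pose h (b : bool) := [set (b%:R : L) + y | y in P].
  have h01 : h true <> h false.
    by move/(eq_coset idP); rewrite subr0; apply: maximal_proper.
  rewrite -card_le_II -(card_le_eqr cm); apply/card_subP; exists (h @` [set: bool]).
    rewrite -card_bool; apply: card_eq_trans (card_finType bool).
    by apply: inj_card_eq => -[] [] // _ _ /esym.
  by move=> _ [b _ <-]; exists b%:R => //; apply: integers_nat.
have [w w0 wE] := polya_Pi_principal polyaL q1.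
move: (wE); rewrite Pi_ideal_cap // => capE.
set S := maximal_ideals_of_norm {:L}%AS q in capE.
have wI x : (exists2 y, O y & x = w * y) <-> (O x /\ forall P, S P -> P x).
  move/seteqP: capE => [c1 c2]; split=> [[y Oy ->]|]; first by apply: c2; exists y.
  by case/c1=> y Oy <-; exists y.
have SP : S P by split.
have [Ow Sw] : O w /\ forall P, S P -> P w.
  by apply/wI; exists 1; [apply: integers1 | rewrite mulr1].
(* The group permutes the maximal ideals of norm [q], so [g w] lies in all of them and is a multiple
   of [w]. *)
have Ogw (g : gal_of {:L}) : O (g w / w).
  have /wI[y Oy ->] : O (g w) /\ forall P, S P -> P (g w).
    split=> [|Q SQ]; first exact: integers_gal.
    exact: (Sw _ (maximal_gal_preimage g SQ)).
  by rewrite mulrC mulKf.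
have Ugw (g : gal_of {:L}) : U (g w / w).
  apply/unitsP; split=> //; first by rewrite mulf_neq0 ?invr_eq0 ?fmorph_eq0.
  have -> : (g w / w)^-1 = g ((g^-1)%g w / w) by rewrite invf_div fmorph_div /= galKV.
  exact: integers_gal.
have [v Uv Nw] : exists2 v, U v & galNorm 1 {:L} w = w ^+ n * v.
  exists (\prod_(g in 'Gal({:L} / 1)%g) (g w / w)); first exact: units_prod.
  rewrite prodf_div prodr_const; rewrite mulrC divfK //.
  by rewrite expf_neq0.
have [z Nz] := gal_norm_int galL Ow.
have [c Oc pwc] : exists2 c, O c & p%:R = w * c.
  apply/wI; split=> [|Q SQ]; first exact: integers_nat.
  by case: SQ => maxQ Qq; exact: (same_norm_prime maxP maxQ pr_p q1 Pq Qq Pp).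
have [z' Nz'] := gal_norm_int galL Oc.
have zz : (p%:Z ^+ n = z * z')%R.
  apply: (@intr_inj_numfield L); rewrite rmorphM /= -Nz -Nz' -galNormM -pwc.
  rewrite rmorphXn /= -pmulrn /galNorm.
  by under eq_bigr do rewrite rmorph_nat; rewrite prodr_const.
(* The norm of [w] divides that of [p], which is [p ^ n], so it is a power of [p] up to sign. *)
have [k zk] : exists k, `|z|%N = (p ^ k)%N.
  have : (`|z| %| p ^ n)%N.
    by rewrite -[(p ^ n)%N]/(`|(p ^ n)%N%:Z|)%N -natz natrX !natz zz abszM dvdn_mulr.
  by case/(dvdn_pfactor _ _ pr_p) => k _ ->; exists k.
have [u Uu wu] : exists2 u, U u & w ^+ n = p%:R ^+ k * u.
  exists ((-1) ^+ (z < 0)%R / v); first by apply: unitsM; [apply/unitsX/unitsN1 | apply: unitsV].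
  have -> : w ^+ n = z%:~R / v.
    by rewrite -Nz Nw mulfK ?(units_neq0 Uv).
  by rewrite {1}[z]intEsign zk rmorphM rmorphXn rmorphN1 /= -pmulrn natrX; ring.
(* If [k = j * n], then [w / p ^ j] is a unit. Since [w] lies in [P], it is no unit itself, so
   [j > 0] and [p] divides [w]. *)
exists w, k, u; split=> //; apply/negP => /dvdnP[j kj].
have p0 : (p%:R : L) != 0 by rewrite natr_eq0_numfield -lt0n prime_gt0.
have Uwp : U (w / p%:R ^+ j).
  apply: (@units_root _ _ n); first exact: cardG_gt0.
  by rewrite expr_div_n wu -exprM -kj mulrAC divff ?mul1r // expf_neq0.
have [x Ox wx] : exists2 x, O x & w = p%:R * x.
  case: j => [|j] in Uwp kj *.
    case: (maximal_proper maxP); rewrite expr0 divr1 in Uwp.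
    case/unitsP: Uwp => _ _ Ow'; rewrite -(mulVf w0).
    by apply: mem_idealMl => //; exact: (Sw _ SP).
  exists (p%:R ^+ j * (w / p%:R ^+ j.+1)).
    by apply: integersM; [apply/integersX/integers_nat | apply: units_int].
  by rewrite mulrA -exprS mulrC divfK // expf_neq0.
(* Multiplication by this [b] maps [P] into [w O], while [b] is 1 modulo [P]. *)
have [b [Ob Sb Pb]] : exists b, [/\ O b, forall Q, S Q -> Q <> P -> Q b & P (1 - b)].
  pose s := [seq Q <- fset_set S | Q != P].
  have finS := finite_maximal_ideals_of_norm L q1.
  have Ps : P \notin s by rewrite mem_filter eqxx.
  have [|b [Ob sb Pb]] := comaximal_witness maxP Ps.
    by move=> Q; rewrite mem_filter in_fset_set // => /andP[_ /set_mem[]].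
  exists b; split=> // Q SQ /eqP QP; apply: sb.
  by rewrite mem_filter QP in_fset_set //; apply: mem_set.
have capP y : P y -> exists2 t, O t & y * b = w * t.
  move=> Py; apply/wI; split=> [|Q SQ].
    by apply: integersM => //; apply: ideal_int Py.
  have [->|QP] := pselect (Q = P); first exact: mem_idealMr.
  apply: mem_idealMl; [by case: SQ => /maximal_ideal|exact: ideal_int Py|exact: Sb].
(* The second summand is a multiple of [w], hence of [p], and [p O] lies in [P ^ 2] by
   ramification. *)
have PsubP2 y : P y -> ideal_mul P P y.
  move=> Py; have -> : y = y * (1 - b) + y * b by ring.
  apply: ideal_mulD; first exact: mem_ideal_mul.
  have [t Ot ->] := capP y Py; rewrite wx -mulrA; apply: P2; exact: integersM.
(* In a sum of products from [P ^ 2] equal to [w], one factor of each product is multiplied by [b],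
   which brings out [w]. Cancelling [w] then puts [b] into [P]. *)
have [t Pt wbt] : exists2 t, P t & w * b = w * t.
  have : ideal_mul P P w := PsubP2 _ (Sw _ SP).
  move: {1 2}w; apply: ideal_mul_ind.
  - by exists 0; [apply: mem_ideal0 | rewrite mul0r mulr0].
  - by move=> y1 y2 [t1 Pt1 e1] [t2 Pt2 e2]; exists (t1 + t2);
      [apply: mem_idealD | rewrite mulrDl e1 e2 mulrDr].
  move=> y1 y2 Py1 /capP[t Ot e]; exists (y1 * t); first exact: mem_idealMr.
  by rewrite -mulrA e; ring.
apply: (maximal_proper maxP); have -> : 1 = (1 - b) + t.
  by rewrite -(mulfI w0 wbt) subrK.
exact: mem_idealD.
Qed.

End RamifiedPrimes.

(** * Multiplicative dependence of units *)

Lemma ler_exp2_bound (y : algC) : exists k : nat, `|y| <= 2 ^+ k.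
Proof.
exists (Num.Def.archi_bound `|y|); apply: ltW.
apply: lt_le_trans (archi_boundP (normr_ge0 y)) _.
by rewrite -natrX ler_nat ltnW // ltn_expl.
Qed.

(** The index [j] is the integer part of the base 2 logarithm of [y]; these intervals are the boxes
    of the pigeonhole argument. *)
Lemma dyadic_interval (y : algC) T : 1 <= y -> y <= 2 ^+ T ->
  exists j : 'I_T.+1, 2 ^+ j <= y /\ y < 2 ^+ j.+1.
Proof.
move=> y1; have yR : y \is Num.real by rewrite ger0_real // (le_trans ler01).
elim: T => [|T IHT] yT.
  by exists ord0; rewrite expr0 expr1 y1 (le_lt_trans yT) // expr0 ltr1n.
have [y_eq|y_neq] := eqVneq y (2 ^+ T.+1).
  by exists ord_max; rewrite y_eq lexx [X in _ < X]exprS ltr_pMl ?exprn_gt0 ?ltr1n ?ltr0n.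
have pR : (2 ^+ T : algC) \is Num.real by rewrite rpredX // realn.
case: (real_leP yR pR) => [/IHT[j jy]|lt]; first by exists (widen_ord (leqnSn _) j).
by exists (inord T); rewrite inordK // (ltW lt) lt_neqAle y_neq.
Qed.

Section UnitRank.
Variable L : splittingFieldType rat.
Hypothesis galL : galois 1 {:L}%AS.
Notation O := (ring_of_integers {:L}%AS).
Notation U := (unit_group {:L}%AS).
Variable f : {rmorphism L -> algC}.

(** The norm is an integer of absolute value below 1, hence 0. *)
Lemma small_integer_eq0 x :
  O x -> (forall g : gal_of {:L}, `|f (g x)| < 1) -> x = 0.
Proof.
move=> Ox x1; have [z Nz] := gal_norm_int galL Ox; apply/eqP.
rewrite -(galNorm_eq0 1 {:L}) Nz -[X in _ == X](rmorph0 (intr : int -> L)).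
rewrite (inj_eq (@intr_inj_numfield L)).
have : `|(z%:~R : algC)| < 1.
  rewrite -(rmorph_int f) -Nz /galNorm rmorph_prod normr_prod.
  rewrite (bigD1 1%g) ?group1 //=; apply: le_lt_trans (x1 1%g); apply: ler_piMr => //.
  by apply: prodr_ile1 => g _; rewrite normr_ge0 ltW.
by rewrite -intr_norm -[1]/(1%:~R) ltr_int; case: z {Nz} => [[|k]|k].
Qed.

(** Here [s] represents all archimedean absolute values. Among many monomials in the [u i], two
    agree modulo 5 and have absolute values in the same dyadic boxes. Their quotient is [1 + 5 x]
    with all conjugates below 2 in absolute value, so those of [x] are below [3 / 5], and
    [x = 0]. *)
Lemma units_dependent d (s : 'I_d -> gal_of {:L}) (I : finType) (u : I -> L) :
    (forall g : gal_of {:L}, exists i, forall x, `|f (g x)| = `|f (s i x)|) ->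
    (forall i, U (u i)) -> (d < #|I|)%N ->
  exists c : I -> int, (exists i, c i != 0) /\ \prod_i u i ^ c i = 1.
Proof.
move=> sP Uu lt_dI.
have u0 i : u i != 0 := units_neq0 (Uu i).
have [M uM] : exists M : nat, forall i j,
    `|f (s j (u i))| <= 2 ^+ M /\ `|(f (s j (u i)))^-1| <= 2 ^+ M.
  have /choice[b bP] : forall ij : I * 'I_d, exists k : nat,
      `|f (s ij.2 (u ij.1))| <= 2 ^+ k /\ `|(f (s ij.2 (u ij.1)))^-1| <= 2 ^+ k.
    move=> ij; have [k1 le1] := ler_exp2_bound (f (s ij.2 (u ij.1))).
    have [k2 le2] := ler_exp2_bound ((f (s ij.2 (u ij.1)))^-1).
    exists (k1 + k2)%N; split; [apply: le_trans le1 _ | apply: le_trans le2 _];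
      by rewrite ler_weXn2l ?ler1n ?leq_addr ?leq_addl.
  exists (\sum_ij b ij)%N => i j; have [le1 le2] := bP (i, j).
  by split; [apply: le_trans le1 _ | apply: le_trans le2 _];
    rewrite ler_weXn2l ?ler1n // (bigD1 (i, j)) //= leq_addr.
pose I5 := [set 5%:R * x | x in O].
have idI5 : is_ideal {:L}%AS I5 := principal_ideal L 5.
have [|r [phi [phiO phi_inj phi_surj]]] := quotient_representatives idI5 (isT : prime 5).
  by exists 1; [apply: integers1 | rewrite mulr1].
(* For exponents below [B], absolute values of monomials lie between [2 ^ - T] and [2 ^ T], giving
   [2 T + 1] boxes at each of [d] places. Since [2 T + 1 <= (2 M m + 1) B], the choice of [B] makes
   the number of boxes times the [5 ^ r] residues less than [B ^ (d + 1)], hence less than the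
   number [B ^ m] of monomials. *)
pose m := #|I|; pose B := ((2 * M * m).+1 ^ d * 5 ^ r).+1; pose T := (M * m * B)%N.
pose w (k : {ffun I -> 'I_B}) := \prod_i u i ^+ k i.
have Uw k : U (w k) by apply: units_prod => i _; apply: unitsX.
have /choice[res resP] : forall k, exists a, I5 (w k - phi a).
  by move=> k; apply/phi_surj/units_int.
have upper (k : {ffun I -> 'I_B}) (y : I -> algC) : (forall i, `|y i| <= 2 ^+ M) ->
    `|\prod_i y i ^+ k i| <= 2 ^+ T.
  move=> yM; rewrite normr_prod /T mulnAC exprM -prodr_const.
  apply: ler_prod => i _; rewrite normr_ge0 normrX exprM /=.
  apply: (@le_trans _ _ ((2 ^+ M) ^+ k i)).
    by rewrite lerXn2r ?nnegrE ?normr_ge0 ?exprn_ge0 ?ler0n.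
  by rewrite ler_weXn2l ?exprn_ege1 ?ler1n // ltnW.
have wbox k j : 2 ^- T <= `|f (s j (w k))| /\ `|f (s j (w k))| <= 2 ^+ T.
  have wE : f (s j (w k)) = \prod_i (f (s j (u i))) ^+ k i.
    by rewrite !rmorph_prod; apply: eq_bigr => i _; rewrite !rmorphXn.
  split; last by rewrite wE; apply: upper => i; case: (uM i j).
  have y0 : f (s j (w k)) != 0 by rewrite !fmorph_eq0 (units_neq0 (Uw k)).
  rewrite -[leRHS]invrK lef_pV2 ?posrE ?invr_gt0 ?exprn_gt0 ?normr_gt0 ?ltr0n // -normfV.
  rewrite wE -prodfV; under eq_bigr do rewrite -exprVn.
  by apply: upper => i; case: (uM i j).
have p2 : (0 : algC) < 2 ^+ T by rewrite exprn_gt0 ?ltr0n.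
have /choice[box boxP] : forall kj : {ffun I -> 'I_B} * 'I_d, exists b : 'I_(T + T).+1,
    2 ^+ b <= `|f (s kj.2 (w kj.1))| * 2 ^+ T /\ `|f (s kj.2 (w kj.1))| * 2 ^+ T < 2 ^+ b.+1.
  move=> [k j] /=; have [lo hi] := wbox k j; apply: dyadic_interval.
  - by rewrite -[X in X <= _](mulVf (lt0r_neq0 p2)) ler_pM2r.
  - by rewrite exprD ler_pM2r.
pose F k := ([ffun j => box (k, j)], res k).
have [/injectiveP/leq_card|/injectivePn[k [k' kk' Fkk']]] := boolP (injectiveb F).
  rewrite card_prod !card_ffun !card_ord leqNgt => /negP[].
  have le_T : ((T + T).+1 <= (2 * M * m).+1 * B)%N by rewrite /T /B; nia.
  apply: (@leq_trans (B ^ d.+1)); last by rewrite leq_pexp2l.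
  apply: (@leq_ltn_trans ((2 * M * m).+1 ^ d * B ^ d * 5 ^ r)).
    by rewrite -expnMn leq_mul //; case: (d) => // d'; rewrite leq_exp2r.
  by rewrite expnS mulnAC ltn_pmul2r ?expn_gt0.
exists (fun i => (k i : nat)%:Z - (k' i : nat)%:Z); split.
  have /existsP[i ki] : [exists i, k i != k' i].
    rewrite -negb_forall; apply: contra kk' => /forallP kk'.
    by apply/eqP/ffunP => i; apply/eqP.
  by exists i; rewrite subr_eq0 eqz_nat.
have -> : \prod_i u i ^ ((k i : nat)%:Z - (k' i : nat)%:Z) = w k / w k'.
  by rewrite /w -prodf_div; apply: eq_bigr => i _; rewrite expfzDr // -exprnN.
have wk'0 := units_neq0 (Uw k').
have [Fbox Fres] : (forall j, box (k, j) = box (k', j)) /\ res k = res k'.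
  case: Fkk' => /ffunP Fb Fr; split=> // j.
  by have := Fb j; rewrite !ffunE.
have [x Ox xE] : exists2 x, O x & w k / w k' - 1 = 5%:R * x.
  have [x Ox xE] : I5 (w k - w k').
    have -> : w k - w k' = (w k - phi (res k)) - (w k' - phi (res k')) by rewrite Fres; ring.
    exact: mem_idealB.
  exists (x / w k'); first by apply: integersM => //; apply/units_int/unitsV.
  by rewrite mulrA xE mulrBl divff.
suffices x0 : x = 0 by apply/eqP; rewrite -subr_eq0 xE x0 mulr0.
apply: small_integer_eq0 => // g; have [j gj] := sP g.
(* Two numbers in the same dyadic interval have ratio below 2. *)
have lt2 : `|f (g (w k / w k'))| < 2.
  have [_ hi] := boxP (k, j); have [lo _] := boxP (k', j).
  rewrite gj fmorph_div /= fmorph_div normrM normfV ltr_pdivrMr ?normr_gt0 ?fmorph_eq0 //.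
  rewrite -(ltr_pM2r p2) (lt_le_trans hi) //= Fbox exprS -mulrA ler_pM2l ?ltr0n //.
have -> : x = (w k / w k' - 1) / 5%:R.
  by rewrite xE mulrAC divff ?mul1r // natr_eq0_numfield.
rewrite fmorph_div /= fmorph_div !rmorph_nat normrM normfV ltr_pdivrMr ?normr_gt0 ?pnatr_eq0 //.
rewrite normr_nat mul1r !rmorphB !rmorph1 /=.
apply: le_lt_trans (ler_normB _ _) _; rewrite normr1.
apply: (@lt_trans _ _ 3); last by rewrite ltr_nat.
by rewrite -[3]/(2 + 1)%:R natrD ltrD2r.
Qed.

End UnitRank.

Lemma logn_prod_prime_powers (I : finType) (p a : I -> nat) i :
    (forall i, prime (p i)) -> injective p ->
  logn (p i) (\prod_j p j ^ a j) = a i.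
Proof.
move=> pr_p p_inj.
have lognE (r : seq I) : logn (p i) (\prod_(j <- r) p j ^ a j) = (\sum_(j <- r | j == i) a j)%N.
  elim: r => [|j r IHr]; first by rewrite !big_nil logn1.
  have pos m : (0 < p m ^ a m)%N by rewrite expn_gt0 prime_gt0.
  rewrite !big_cons lognM ?prodn_gt0 //.
  rewrite IHr lognX logn_prime // (inj_eq p_inj) eq_sym.
  by case: ifP; rewrite ?muln1 ?muln0.
by rewrite lognE big_pred1_eq.
Qed.

(** * Relations between rational primes *)

Section RationalRelations.
Variable L : splittingFieldType rat.
Hypothesis galL : galois 1 {:L}%AS.
Notation O := (ring_of_integers {:L}%AS).
Notation U := (unit_group {:L}%AS).

Lemma rat_unit_int (x : rat) : U (GRing.in_alg L x) -> exists z : int, x = z%:~R /\ `|z|%N = 1%N.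
Proof.
have [f] := complex_embedding_exists galL.
case/unitsP; rewrite fmorph_eq0 -fmorphV => x0 /(rat_integer f)[z zE] /(rat_integer f)[z' z'E].
exists z; split=> //; have : (z * z')%R = 1.
  by apply: (@intr_inj rat); rewrite rmorphM /= -zE -z'E divff.
by move/(congr1 absz); rewrite abszM => /eqP; rewrite muln_eq1 => /andP[/eqP].
Qed.

(** The relation makes [v] a rational unit, hence 1 or -1; comparing valuations at [p i] gives
    [b i = a i] plus [h] times the valuation of [r]. *)
Lemma prime_relation_mod (I : finType) (p a b : I -> nat) h (r : rat) (v : L) :
    (forall i, prime (p i)) -> injective p -> r != 0 -> U v ->
    GRing.in_alg L r ^+ h * \prod_i (p i)%:R ^+ a i * v = \prod_i (p i)%:R ^+ b i :> L ->
  forall i, a i = b i %[mod h].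
Proof.
move=> pr_p p_inj r0 Uv rel i.
have natE (c : I -> nat) :
    \prod_i (p i)%:R ^+ c i = GRing.in_alg L ((\prod_i p i ^ c i)%N%:R : rat).
  by rewrite rmorph_nat natr_prod; apply: eq_bigr => j _; rewrite natrX.
have pos (c : I -> nat) : (0 < \prod_i p i ^ c i)%N.
  by apply/prodn_gt0 => j; rewrite expn_gt0 prime_gt0.
move: rel; rewrite !natE -rmorphXn -rmorphM; set A := (\prod_i p i ^ a i)%N.
set B := (\prod_i p i ^ b i)%N => rel.
have rA0 : r ^+ h * A%:R != 0 by rewrite mulf_neq0 ?expf_neq0 // pnatr_eq0 -lt0n pos.
have vE : v = GRing.in_alg L (B%:R / (r ^+ h * A%:R)).
  rewrite fmorph_div; apply: (canRL (mulfK _)); first by rewrite fmorph_eq0.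
  by rewrite mulrC.
have [z [zE z1]] : exists z : int, B%:R / (r ^+ h * A%:R) = z%:~R /\ `|z|%N = 1%N.
  by apply: rat_unit_int; rewrite -vE.
have key : (numq r ^+ h * A * z = denq r ^+ h * B :> int)%R.
  apply: (@intr_inj rat); rewrite !rmorphM !rmorphXn /= -zE.
  have -> : ((numq r)%:~R : rat) = r * (denq r)%:~R by rewrite numqE.
  have e (m : nat) : (m%:Z)%:~R = m%:R :> rat by rewrite pmulrn.
  rewrite !e exprMn; move: rA0; rewrite mulf_eq0 negb_or => /andP[x0 y0].
  by field; rewrite x0 y0.
have {}key : (`|numq r| ^ h * A = `|denq r| ^ h * B)%N.
  by have := congr1 absz key; rewrite !abszM !abszX z1 muln1.
have num0 : (0 < `|numq r|)%N by rewrite absz_gt0 numq_eq0.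
have den0 : (0 < `|denq r|)%N by rewrite absz_gt0 denq_eq0.
have := congr1 (logn (p i)) key; rewrite !lognM ?expn_gt0 ?num0 ?den0 ?pos // !lognX.
rewrite !logn_prod_prime_powers // => /(congr1 (modn^~ h)).
by rewrite ![(h * _)%N]mulnC !modnMDl.
Qed.

End RationalRelations.

(** * Conjugation on the quadratic subfield and the primes with odd exponent *)

Section QuadraticSubfield.
Variables (L : splittingFieldType rat) (E : {subfield L}) (l : nat).
Hypotheses (galL : galois 1 {:L}%AS) (E2 : \dim E = 2%N) (pr_l : prime l).
Hypothesis cardG : #|'Gal({:L} / 1)%g| = (2 * l)%N.
Notation O := (ring_of_integers {:L}%AS).
Notation U := (unit_group {:L}%AS).
Notation H := 'Gal({:L} / E)%g.

Let galE : galois E {:L}.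
Proof. by apply: galoisS galL; rewrite sub1v subvf. Qed.

Lemma mem_gal1 (g : gal_of {:L}) : g \in 'Gal({:L} / 1)%g.
Proof. by rewrite gal_kHom ?sub1v // k1AHom. Qed.

Lemma card_gal_quadratic : #|H| = l.
Proof.
rewrite -(galois_dim galE) E2.
have := galois_dim galL; rewrite dimv1 divn1 cardG => ->.
by rewrite mulKn.
Qed.

Lemma mem_quadraticP x : reflect (forall h, h \in H -> h x = x) (x \in E).
Proof.
by rewrite -[in X in reflect _ X](galois_fixedField galE); apply/fixedFieldP/memvf.
Qed.

Lemma gal_quadratic_sub : H \subset 'Gal({:L} / 1)%g.
Proof. exact/galS/sub1v. Qed.

Lemma index_gal_quadratic : #|'Gal({:L} / 1)%g : H|%g = 2%N.
Proof. by rewrite -divgS ?gal_quadratic_sub // cardG card_gal_quadratic mulnK ?prime_gt0. Qed.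

Variable tau : gal_of {:L}.
Hypothesis tauH : tau \notin H.

Lemma gal_coset_quadratic g : g \notin H -> exists2 h, h \in H & g = (h * tau)%g.
Proof.
move=> gH; have : g \in (H :* tau)%g.
  rewrite (rcoset_index2 gal_quadratic_sub index_gal_quadratic) ?inE ?gH ?mem_gal1 //.
  by rewrite tauH.
by case/rcosetP=> h Hh ->; exists h.
Qed.

Lemma quadratic_conj_mem x : x \in E -> tau x \in E.
Proof.
move=> Ex; apply/mem_quadraticP => h Hh.
have : (tau * h)%g \notin H by rewrite groupMr.
case/gal_coset_quadratic => h' Hh' e.
by rewrite -galM ?memvf // e galM ?memvf // (elimT (mem_quadraticP _) Ex h').
Qed.

Lemma quadratic_fixed_rat x : x \in E -> tau x = x -> exists r, x = GRing.in_alg L r.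
Proof.
move=> Ex tx; apply: (gal_fixed_rat galL) => g _.
have [Hg|/gal_coset_quadratic[h Hh ->]] := boolP (g \in H); first exact: mem_quadraticP.
by rewrite galM ?memvf // (elimT (mem_quadraticP _) Ex h).
Qed.

Lemma quadratic_conjK x : x \in E -> tau (tau x) = x.
Proof.
move=> Ex; rewrite -galM ?memvf //; apply: (mem_quadraticP _ Ex).
apply: contraR tauH => /gal_coset_quadratic[h Hh e].
by rewrite (mulIg _ _ _ e).
Qed.

Lemma quadratic_norm_rat x : x \in E -> exists r, x * tau x = GRing.in_alg L r.
Proof.
move=> Ex; apply: quadratic_fixed_rat; first by rewrite rpredM ?quadratic_conj_mem.
by rewrite rmorphM /= quadratic_conjK // mulrC.
Qed.

Lemma quadratic_norm_unit x : x \in E -> U x ->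
  exists z : int, x * tau x = z%:~R /\ `|z|%N = 1%N.
Proof.
move=> Ex Ux; have [r rE] := quadratic_norm_rat Ex.
have [|z [zE z1]] := rat_unit_int galL (x := r).
  by rewrite -rE; apply: unitsM => //; apply: units_gal.
by exists z; rewrite rE zE rmorph_int.
Qed.

(* k / (2 l) is the valuation of w, normalized by v(p) = 1. *)
Definition prime_generator (p k : nat) (w : L) :=
  [/\ w != 0, forall g : gal_of {:L}, U (g w / w) &
      exists2 u, U u & w ^+ (2 * l) = p%:R ^+ k * u].

Lemma galNorm_generator (w : L) : w != 0 -> (forall g : gal_of {:L}, U (g w / w)) ->
  exists2 u, U u & galNorm E {:L} w = w ^+ l * u.
Proof.
move=> w0 Uw; exists (\prod_(h in H) (h w / w)); first exact: units_prod.
by rewrite prodf_div prodr_const card_gal_quadratic mulrC divfK // expf_neq0.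
Qed.

(** The family [c] represents the units of [E] modulo those of the form [tau y / y]; the pigeonhole
    compares it with the [2 ^ a] subsets of the primes. *)
Lemma card_odd_generators a (T : finType) (c : T -> L)
    (p k : 'I_a -> nat) (w : 'I_a -> L) :
    (forall t, c t != 0) ->
    (forall u, u \in E -> U u ->
       exists t y, [/\ y \in E, U y & u = c t * (tau y / y)]) ->
    (forall i, prime (p i)) -> injective p ->
    (forall i, prime_generator (p i) (k i) (w i)) -> (forall i, odd (k i)) ->
  (2 ^ a <= #|T|)%N.
Proof.
move=> c0 cP pr_p p_inj wP odd_k; rewrite leqNgt; apply/negP => lt_T.
have w0 i : w i != 0 by case: (wP i).
pose b i := galNorm E {:L} (w i).
have bE i : b i \in E := mem_galNorm galE (memvf _).
have b0 i : b i != 0 by rewrite galNorm_eq0.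
(* Up to units, [b i] is [w i ^ l], so its square is [w i ^ (2 l)], a power of [p i]. *)
have b2 i : exists2 u, U u & b i ^+ 2 = (p i)%:R ^+ k i * u.
  have [_ Uw [u Uu wu]] := wP i; have [v Uv bv] := galNorm_generator (w0 i) Uw.
  exists (u * v ^+ 2); first by apply: unitsM => //; apply: unitsX.
  by rewrite /b bv exprMn -exprM [(l * 2)%N]mulnC wu mulrA.
have bt i : U (tau (b i) / b i).
  rewrite /b /galNorm rmorph_prod -prodf_div; apply: units_prod => h _ /=.
  case: (wP i) => _ Uw _; rewrite -galM ?memvf //.
  have -> : (h * tau)%g (w i) / h (w i) = ((h * tau)%g (w i) / w i) / (h (w i) / w i).
    by rewrite invf_div mulrA divfK ?w0.
  by apply: unitsM => //; apply: unitsV.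
pose bS (S : {set 'I_a}) := \prod_(i in S) b i.
have bS0 S : bS S != 0 by apply/prodf_neq0 => i _.
have bSE S : bS S \in E by apply: rpred_prod => i _.
have bS_unit S : U (tau (bS S) / bS S).
  by rewrite rmorph_prod -prodf_div; apply: units_prod => i _; apply: bt.
have bS_unitE S : tau (bS S) / bS S \in E by rewrite rpred_div ?quadratic_conj_mem.
have /choice[cls clsP] : forall S, exists t, exists y,
    [/\ y \in E, U y & tau (bS S) / bS S = c t * (tau y / y)].
  by move=> S; apply: cP.
have [/injectiveP/leq_card|/injectivePn[S [S' SS' clsS]]] := boolP (injectiveb cls).
  by rewrite -[#|{set _}|]cardsT -powersetT card_powerset cardsT card_ord leqNgt lt_T.
have [y [Ey Uy e]] : exists y,
    [/\ y \in E, U y & (tau (bS S) / bS S) / (tau (bS S') / bS S') = tau y / y].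
  have [y1 [Ey1 Uy1 e1]] := clsP S; have [y2 [Ey2 Uy2 e2]] := clsP S'.
  exists (y1 / y2); split; [exact: rpred_div | by apply: unitsM => //; apply: unitsV |].
  rewrite e1 e2 clsS fmorph_div /=; field.
  by rewrite !fmorph_eq0 c0 !units_neq0.
have y0 := units_neq0 Uy.
(* Two subsets in the same class make [x] invariant under [tau], hence rational; the parities of the
   valuations of its square then identify the subsets. *)
pose x := bS S / (bS S' * y).
have x0 : x != 0 by rewrite !mulf_neq0 ?invr_eq0 ?mulf_neq0.
have tx : tau x = x.
  rewrite /x fmorph_div rmorphM /=.
  have -> : tau (bS S) = bS S * (tau (bS S') / bS S' * (tau y / y)).
    rewrite -e [X in _ * X]mulrC divfK; first by rewrite mulrC divfK.
    by rewrite mulf_neq0 ?invr_eq0 ?fmorph_eq0.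
  by field; rewrite !fmorph_eq0 !bS0 y0.
have [r xr] : exists r, x = GRing.in_alg L r.
  by apply: quadratic_fixed_rat tx; rewrite !(rpred_div, rpredM).
have sq (A : {set 'I_a}) : exists2 u, U u &
    bS A ^+ 2 = \prod_i (p i)%:R ^+ (k i * (i \in A))%N * u.
  have /choice[z zP] : forall i, exists z, U z /\ b i ^+ 2 = (p i)%:R ^+ k i * z.
    by move=> i; have [u Uu bu] := b2 i; exists u.
  exists (\prod_(i in A) z i); first by apply: units_prod => i _; case: (zP i).
  rewrite /bS -prodrXl [\prod_(i in A) z i]big_mkcond [LHS]big_mkcond -big_split /=.
  apply: eq_bigr => i _; case: ifP => _; last by rewrite muln0 expr0 mul1r.
  by rewrite muln1; case: (zP i).
have [u Uu bu] := sq S; have [u' Uu' bu'] := sq S'.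
have u0 := units_neq0 Uu.
have r0 : r != 0 by move: x0; rewrite xr fmorph_eq0.
have rel := @prime_relation_mod L galL _ p (fun i => k i * (i \in S'))%N
  (fun i => k i * (i \in S))%N 2 r (u' * y ^+ 2 / u) pr_p p_inj r0.
case/eqP: SS'; apply/setP => i.
have : (k i * (i \in S'))%N = (k i * (i \in S))%N %[mod 2].
  apply: rel; first by apply: unitsM; [apply: unitsM => //; apply: unitsX | apply: unitsV].
  rewrite -xr; apply: (mulIf u0); rewrite -bu !mulrA divfK //.
  have -> : bS S = x * (bS S' * y) by rewrite /x divfK // mulf_neq0.
  by rewrite !exprMn bu'; ring.
by rewrite !modn2 !oddM odd_k; case: (i \in S) (i \in S') => [] [].
Qed.

End QuadraticSubfield.

(** * Units of relative norm one *)

(* Written additively, so that group ring arguments become linear algebra. *)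
Section NormOneUnits.
Variables (L : splittingFieldType rat) (E : {subfield L}).
Notation U := (unit_group {:L}%AS).

Definition norm_one_unit : pred L := fun x => `[<U x /\ galNorm E {:L} x = 1>].

Definition normOneUnits := {x : L | norm_one_unit x}.

HB.instance Definition _ := [Choice of normOneUnits by <:].

Lemma norm_one_unitP (x : normOneUnits) : U (val x) /\ galNorm E {:L} (val x) = 1.
Proof. exact/asboolP/(valP x). Qed.

Fact norm_one_unit1 : norm_one_unit 1.
Proof. by apply/asboolP; split; [apply: units1 | apply: galNorm1]. Qed.

Fact norm_one_unitV (x : normOneUnits) : norm_one_unit (val x)^-1.
Proof.
have [Ux Nx] := norm_one_unitP x.
by apply/asboolP; split; [apply: unitsV | rewrite galNormV Nx invr1].
Qed.

Fact norm_one_unitM (x y : normOneUnits) : norm_one_unit (val x * val y).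
Proof.
have [Ux Nx] := norm_one_unitP x; have [Uy Ny] := norm_one_unitP y.
by apply/asboolP; split; [apply: unitsM | rewrite galNormM Nx Ny mulr1].
Qed.

Definition nou_zero : normOneUnits := Sub 1 norm_one_unit1.
Definition nou_opp (x : normOneUnits) : normOneUnits := Sub _ (norm_one_unitV x).
Definition nou_add (x y : normOneUnits) : normOneUnits := Sub _ (norm_one_unitM x y).

Fact nou_addA : associative nou_add.
Proof. by move=> x y z; apply: val_inj; rewrite !SubK mulrA. Qed.
Fact nou_addC : commutative nou_add.
Proof. by move=> x y; apply: val_inj; rewrite !SubK mulrC. Qed.
Fact nou_add0 : left_id nou_zero nou_add.
Proof. by move=> x; apply: val_inj; rewrite !SubK mul1r. Qed.
Fact nou_addN : left_inverse nou_zero nou_opp nou_add.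
Proof.
move=> x; apply: val_inj; rewrite !SubK mulVf //.
by have [/units_neq0] := norm_one_unitP x.
Qed.

HB.instance Definition _ := GRing.isZmodule.Build normOneUnits
  nou_addA nou_addC nou_add0 nou_addN.

Lemma val_nouD (x y : normOneUnits) : val (x + y) = val x * val y.
Proof. by []. Qed.

Lemma val_nou0 : val (0 : normOneUnits) = 1. Proof. by []. Qed.

Lemma val_nouN (x : normOneUnits) : val (- x) = (val x)^-1.
Proof. by []. Qed.

Lemma val_nou_sum (I : Type) (r : seq I) (F : I -> normOneUnits) :
  val (\sum_(i <- r) F i) = \prod_(i <- r) val (F i).
Proof. by elim: r => [|i r IHr]; rewrite ?big_nil // !big_cons val_nouD IHr. Qed.

Lemma val_nouMn (x : normOneUnits) k : val (x *+ k) = val x ^+ k.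
Proof. by elim: k => // k IHk; rewrite mulrS exprS val_nouD IHk. Qed.

Lemma val_nouMz (x : normOneUnits) (k : int) : val (x *~ k) = val x ^ k.
Proof. by case: k => k; rewrite ?NegzE ?mulrNz ?val_nouN val_nouMn. Qed.

Variable sigma : gal_of {:L}.
Hypothesis sigmaH : sigma \in 'Gal({:L} / E)%g.

Fact norm_one_unit_gal (x : normOneUnits) : norm_one_unit (sigma (val x)).
Proof.
have [Ux Nx] := norm_one_unitP x.
by apply/asboolP; split; [apply: units_gal | rewrite galNorm_gal ?memvf].
Qed.

Definition nou_gal (x : normOneUnits) : normOneUnits := Sub _ (norm_one_unit_gal x).

Fact nou_gal_is_additive : zmod_morphism nou_gal.
Proof. by move=> x y; apply: val_inj; exact: (fmorph_div sigma (val x) (val y)). Qed.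

HB.instance Definition _ := GRing.isZmodMorphism.Build _ _ nou_gal nou_gal_is_additive.

Definition nou_diff (x : normOneUnits) := nou_gal x - x.

Fact nou_diff_is_additive : zmod_morphism nou_diff.
Proof. by move=> x y; rewrite /nou_diff raddfB !opprD addrACA. Qed.

HB.instance Definition _ := GRing.isZmodMorphism.Build _ _ nou_diff nou_diff_is_additive.

Lemma val_nou_diff x : val (nou_diff x) = sigma (val x) / val x.
Proof. by []. Qed.

End NormOneUnits.

(** * Independence modulo [sigma - 1] and the resulting rank bound *)

Section IndependentUnits.
Variables (L : splittingFieldType rat) (E : {subfield L}) (l : nat).
Hypotheses (galL : galois 1 {:L}%AS) (E2 : \dim E = 2%N) (pr_l : prime l).
Hypothesis cardG : #|'Gal({:L} / 1)%g| = (2 * l)%N.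
Notation O := (ring_of_integers {:L}%AS).
Notation U := (unit_group {:L}%AS).
Notation H := 'Gal({:L} / E)%g.
Notation V := (normOneUnits E).

Variable sigma : gal_of {:L}.
Hypothesis sigmaE : H = <[sigma]>%g.
Hypothesis torsE : forall u, u \in E -> U u -> u ^+ l = 1 -> u = 1.

Let sigmaH : sigma \in H. Proof. by rewrite sigmaE cycle_id. Qed.
Let D : {additive V -> V} := nou_diff sigmaH.

Let galE : galois E {:L}.
Proof. by apply: galoisS galL; rewrite sub1v subvf. Qed.

Let cardH : #|H| = l := card_gal_quadratic galL E2 cardG.

Lemma cycle_fixed_mem x : sigma x = x -> x \in E.
Proof.
move=> sx; apply/(mem_quadraticP E galL) => h; rewrite sigmaE => /cycleP[k ->].
by elim: k => [|k IHk]; rewrite ?gal_id // expgSr galM ?memvf // IHk.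
Qed.

Lemma galNorm_mem x : x \in E -> galNorm E {:L} x = x ^+ l.
Proof.
move=> Ex; rewrite /galNorm.
under eq_bigr => h Hh do rewrite (elimT (mem_quadraticP E galL x) Ex h Hh).
by rewrite prodr_const cardH.
Qed.

Lemma galNorm_cycle x : galNorm E {:L} x = \prod_(j < l) (sigma ^+ j)%g x.
Proof.
have os : #[sigma]%g = l by rewrite orderE -sigmaE.
have -> : \prod_(j < l) (sigma ^+ j)%g x = \prod_(j in [set: 'I_l]%SET) (sigma ^+ j)%g x.
  by apply: eq_bigl => j; rewrite inE.
rewrite -(big_imset (fun h : gal_of _ => h x)) /=; last first.
  move=> i j _ _ /eqP; rewrite eq_expg_mod_order os !modn_small ?ltn_ord // => /eqP.
  exact: val_inj.
rewrite /galNorm; apply: eq_bigl => h; rewrite sigmaE.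
apply/cycleP/imsetP => [[k ->]|[j _ ->]]; last by exists j.
exists (Ordinal (ltn_pmod k (prime_gt0 pr_l))); rewrite ?inE //=.
by apply/eqP; rewrite eq_expg_mod_order os modn_mod.
Qed.

(** A unit fixed by [sigma] lies in [E], where the norm is the [l]-th power; norm 1 makes it
    [l]-torsion, and [torsE] applies. *)
Let D_inj x : D x = 0 -> x = 0.
Proof.
move/(congr1 val); rewrite val_nou_diff val_nou0 => e.
have [Ux Nx] := norm_one_unitP x.
have Ex : val x \in E.
  by apply: cycle_fixed_mem; rewrite -[LHS](divfK (units_neq0 Ux)) e mul1r.
by apply: val_inj; rewrite val_nou0; apply: torsE => //; rewrite -galNorm_mem.
Qed.

Let norm0 x : \sum_(j < l) iter j D x *+ 'C(l, j.+1) = 0.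
Proof.
have sE y : nou_gal sigmaH y = y + D y by rewrite /D /= /nou_diff addrC subrK.
rewrite -(sum_iter_add_id _ _ sE); apply: val_inj; rewrite val_nou_sum val_nou0.
rewrite -[RHS](norm_one_unitP x).2 galNorm_cycle; apply: eq_bigr => j _.
elim: (j : nat) => [|k IHk]; first by rewrite gal_id.
by rewrite expgSr galM ?memvf //= IHk.
Qed.

Lemma norm_one_unit_powl (x : V) : exists y : V, val x ^+ l = sigma (val y) / val y.
Proof.
have [y /(congr1 val)] := mull_iterD pr_l norm0 x (prime_gt1 pr_l).
by rewrite val_nouMn => ->; exists y.
Qed.

(** Independence over the field with [l] elements modulo the image of [A] under [sigma - 1]. The set
    [A] will be [U] or the units of norm 1; the condition for [U] is the stronger one. *)
Definition independent_mod_diff t (v : 'I_t -> V) (A : set L) :=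
  forall (c : 'I_t -> nat) y, A y -> \prod_i val (v i) ^+ c i = sigma y / y ->
  forall i, (l %| c i)%N.

(* Adjoining sigma h / h to a system independent modulo (sigma - 1) U costs only independence
   modulo (sigma - 1) V. *)
Lemma independent_mod_diff_cons t (v : 'I_t -> V) (h : L) : U h ->
    (forall (c : nat) q, q \in E -> U q -> galNorm E {:L} h ^+ c = q ^+ l -> (l %| c)%N) ->
    independent_mod_diff v U ->
  exists v' : 'I_t.+1 -> V, independent_mod_diff v' (norm_one_unit E).
Proof.
move=> Uh hP indep; have h0 := units_neq0 Uh.
have Vh : norm_one_unit E (sigma h / h).
  apply/asboolP; split; first by apply: unitsM; [apply: units_gal | apply: unitsV].
  by rewrite galNormM galNormV galNorm_gal ?memvf // divff // galNorm_eq0.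
exists (fun i => if unlift ord0 i is Some j then v j else Sub _ Vh) => c y Vy.
rewrite big_ord_recl unlift_none /= => e.
have {}e : (sigma h / h) ^+ c ord0 * \prod_(i < t) val (v i) ^+ c (lift ord0 i) = sigma y / y.
  by rewrite -e; congr (_ * _); apply: eq_bigr => i _; rewrite liftK.
have [Uy Ny] : U y /\ galNorm E {:L} y = 1 by apply/asboolP.
have y0 := units_neq0 Uy.
(* The power of [sigma h / h] is absorbed into [y], at the cost of replacing [y] by a unit of
   arbitrary norm. *)
have dvd_c i : (l %| c (lift ord0 i))%N.
  apply: (indep (fun i => c (lift ord0 i)) (y / h ^+ c ord0)).
    by apply: unitsM => //; apply/unitsV/unitsX.
  apply: (mulfI (x := (sigma h / h) ^+ c ord0)).
    by rewrite expf_neq0 // mulf_neq0 ?invr_eq0 ?fmorph_eq0.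
  rewrite e fmorph_div rmorphXn expr_div_n /=; field.
  by rewrite y0 !expf_neq0 ?fmorph_eq0.
have [z zE] : exists z : V, \prod_(i < t) val (v i) ^+ c (lift ord0 i) = sigma (val z) / val z.
  have /choice[zz zzP] : forall i, exists z : V, val (v i) ^+ l = sigma (val z) / val z.
    by move=> i; apply: norm_one_unit_powl.
  exists (\sum_i zz i *+ (c (lift ord0 i) %/ l)).
  rewrite val_nou_sum rmorph_prod -prodf_div; apply: eq_bigr => i _ /=.
  by rewrite val_nouMn rmorphXn -expr_div_n -zzP -exprM mulnC divnK.
have [Uz Nz] := norm_one_unitP z; have z0 := units_neq0 Uz.
(* The relation says that [sigma] fixes [q]. As [z] and [y] have norm 1, taking norms gives
   [q ^ l = N(h) ^ c], to which [hP] applies. *)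
pose q := h ^+ c ord0 * val z / y.
have Uq : U q by apply: unitsM; [apply: unitsM => //; apply: unitsX | apply: unitsV].
have Eq : q \in E.
  have sq : sigma q = sigma h ^+ c ord0 * sigma (val z) / sigma y.
    by rewrite /q fmorph_div rmorphM rmorphXn.
  apply: cycle_fixed_mem; rewrite sq /q.
  have -> : sigma y = sigma h ^+ c ord0 / h ^+ c ord0 * (sigma (val z) / val z) * y.
    by rewrite -zE -expr_div_n e divfK.
  have sh0 : sigma h ^+ c ord0 != 0 by rewrite expf_neq0 ?fmorph_eq0.
  have sz0 : sigma (val z) != 0 by rewrite fmorph_eq0.
  have hc0 : h ^+ c ord0 != 0 by rewrite expf_neq0.
  move: sh0 sz0 z0 hc0; set a := sigma h ^+ _; set b := sigma (val z); set d := h ^+ _.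
  by move: (val z) a b d => z' a b d a0 b0 z0 d0; field; rewrite y0 z0 a0 b0 d0.
have dvd_0 : (l %| c ord0)%N.
  apply: (hP _ q) => //; rewrite -galNorm_mem // /q galNormM galNormV galNormM galNormX.
  by rewrite Nz Ny invr1 !mulr1.
by move=> i; case: (unliftP ord0 i) => [j ->|->].
Qed.

(** The [t * (l - 1)] units [D ^ j v_i] are multiplicatively independent, so they cannot outnumber
    the [d] representatives of absolute values. *)
Lemma norm_one_units_rank (f : {rmorphism L -> algC}) d (s : 'I_d -> gal_of {:L})
    t (v : 'I_t -> V) :
    (forall g : gal_of {:L}, exists i, forall x, `|f (g x)| = `|f (s i x)|) ->
    independent_mod_diff v (norm_one_unit E) ->
  (t * l.-1 <= d)%N.
Proof.
move=> sP indep; rewrite leqNgt; apply/negP => lt_d.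
have indep' (c : 'I_t -> nat) y : \sum_i v i *+ c i = D y -> forall i, (l %| c i)%N.
  move/(congr1 val); rewrite val_nou_sum val_nou_diff => e.
  apply: (indep c (val y)); first exact: valP.
  by rewrite -e; apply: eq_bigr => i _; rewrite val_nouMn.
have [||c [[i ci] c1]] := @units_dependent L galL f d s ('I_t * 'I_l.-1)%type
   (fun i => val (iter i.2 D (v i.1))) sP.
- by move=> i; case: (norm_one_unitP (iter i.2 D (v i.1))).
- by rewrite card_prod !card_ord.
case/eqP: ci; apply: (iterD_independent pr_l D_inj norm0 indep').
apply: val_inj; rewrite val_nou_sum val_nou0 -[RHS]c1.
by apply: eq_bigr => j _; rewrite val_nouMz.
Qed.

Variable tau : gal_of {:L}.
Hypothesis tauH : tau \notin H.

(** A relation makes [x], the product of the [w i ^ c i] divided by [y], invariant under [sigma]. So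
    [x] lies in [E] and [r = x * tau x] is rational; up to a unit, [r ^ l] is the product of the
    [p i ^ (k i * c i)], and valuations give [l %| k i * c i]. *)
Lemma generator_units_independent b (p k : 'I_b -> nat) (w : 'I_b -> L) :
    (forall i, prime (p i)) -> injective p ->
    (forall i, prime_generator l (p i) (k i) (w i)) -> (forall i, ~~ (l %| k i)%N) ->
  exists v : 'I_b -> V, independent_mod_diff v U.
Proof.
move=> pr_p p_inj wP ndvd_k.
have w0 i : w i != 0 by case: (wP i).
have Vw i : norm_one_unit E (sigma (w i) / w i).
  apply/asboolP; split; first by case: (wP i).
  by rewrite galNormM galNormV galNorm_gal ?memvf // divff // galNorm_eq0.
exists (fun i => Sub _ (Vw i)) => c y Uy e i; have y0 := units_neq0 Uy.
pose W := \prod_i w i ^+ c i; pose x := W / y.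
have x0 : x != 0 by rewrite mulf_neq0 ?invr_eq0 //; apply/prodf_neq0 => j _; rewrite expf_neq0.
have Ex : x \in E.
  apply: cycle_fixed_mem; rewrite fmorph_div /=.
  have -> : sigma W = W * (sigma y / y).
    rewrite -e /W rmorph_prod -big_split; apply: eq_bigr => j _ /=.
    by rewrite rmorphXn -exprMn mulrC divfK.
  by rewrite /x; field; rewrite fmorph_eq0 y0.
have [r xr] := quadratic_norm_rat galL E2 pr_l cardG tauH Ex.
have r0 : r != 0.
  have : x * tau x != 0 by rewrite mulf_neq0 ?fmorph_eq0.
  by rewrite xr fmorph_eq0.
have [v Uv rel] : exists2 v, U v &
   GRing.in_alg L r ^+ l * \prod_i (p i)%:R ^+ 0 * v = \prod_i (p i)%:R ^+ (k i * c i).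
  have /choice[u uP] : forall j, exists u, U u /\ w j ^+ (2 * l) = (p j)%:R ^+ k j * u.
    by move=> j; case: (wP j) => _ _ [u Uu wu]; exists u.
  have Uy' : U (y * tau y) by apply: unitsM => //; apply: units_gal.
  pose z := \prod_j (u j ^+ c j * (tau (w j) / w j) ^+ (c j * l)).
  have Uz : U z.
    apply: units_prod => j _; apply: unitsM; apply: unitsX; first by case: (uP j).
    by case: (wP j).
  exists ((y * tau y) ^+ l / z); first by apply: unitsM; [apply: unitsX | apply: unitsV].
  rewrite -xr [\prod_j _ ^+ 0]big1 ?mulr1 // mulrA -exprMn.
  apply: (mulIf (units_neq0 Uz)); rewrite divfK ?units_neq0 //.
  have -> : x * tau x * (y * tau y) = W * tau W.
    by rewrite /x fmorph_div /=; field; rewrite fmorph_eq0 y0.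
  rewrite /W rmorph_prod -big_split -prodrXl -big_split; apply: eq_bigr => j _ /=.
  have [_ wu] := uP j; rewrite exprM mulrA -exprMn -wu rmorphXn -exprMn.
  have eN : (2 * l * c j = 2 * (c j * l))%N by rewrite -mulnA [(l * _)%N]mulnC.
  rewrite -!exprM eN [w j ^+ (2 * _)]exprM -exprMn; congr (_ ^+ _).
  by field; exact: w0.
have /esym := prime_relation_mod galL pr_p p_inj r0 Uv rel i.
by rewrite mod0n => /eqP; rewrite -/(l %| _)%N Euclid_dvdM // (negPf (ndvd_k i)).
Qed.

End IndependentUnits.

(** Reduces the bound, including the finiteness of [S], to the absence of [N + 1] distinct
    elements. *)
Lemma card_le_II_inj (S : set nat) N :
    (forall p : 'I_N.+1 -> nat, injective p -> ~ forall i, S (p i)) -> S #<= `I_N.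
Proof.
move=> noS; apply: contrapT => nle.
have : `I_N.+1 #<= S.
  have [/finite_setP[m cS]|/infiniteP leS] := pselect (finite_set S).
    rewrite (card_le_eqr cS) card_le_II leqNgt ltnS; apply/negP => le_mN.
    by apply: nle; rewrite (card_le_eql cS) card_le_II.
  by apply: card_le_trans leS; apply: subset_card_le.
case/card_subP=> C /card_esym/card_set_bijP[f [fC f_inj _]] CS.
apply: (noS (fun i => f i)) => [i j fij|i]; last by apply/CS/fC/ltn_ord.
by apply/val_inj; apply: f_inj => //; apply/mem_set/ltn_ord.
Qed.

Lemma exprz_sign (R : unitRingType) (m : int) : (-1 : R) ^ m = (-1) ^+ `|m|%N.
Proof. by case: m => // n; rewrite NegzE abszN absz_nat -exprnN -exprVn invrN1. Qed.

Lemma small_int_cases (z : int) : (`|z| <= 2)%N ->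
  z = -2 \/ z = -1 \/ z = 0 \/ z = 1 \/ z = 2.
Proof. by lia. Qed.

Lemma int_parity (k : int) : exists (m : int) (d : bool), k = m * 2 + (d : nat).
Proof. by exists (k %/ 2)%Z, (`|(k %% 2)%Z|%N == 1%N); lia. Qed.

Lemma absz_eq1 (z : int) : `|z|%N = 1%N -> z = 1 \/ z = -1.
Proof. by lia. Qed.

(** * Units of the quadratic subfield *)

Section CountingRamifiedPrimes.
Variables (L : splittingFieldType rat) (E : {subfield L}) (l : nat).
Hypotheses (galL : galois 1 {:L}%AS) (E2 : \dim E = 2%N) (pr_l : prime l) (l_gt3 : (3 < l)%N).
Hypothesis cardG : #|'Gal({:L} / 1)%g| = (2 * l)%N.
Notation O := (ring_of_integers {:L}%AS).
Notation U := (unit_group {:L}%AS).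
Notation H := 'Gal({:L} / E)%g.

Let odd_l : odd l.
Proof. by case: (even_prime pr_l) l_gt3 => [->|]. Qed.

Lemma gal_quadratic_cyclic : exists sigma, H = <[sigma]>%g.
Proof. by apply/cyclicP/prime_cyclic; rewrite (card_gal_quadratic galL E2 cardG). Qed.

Lemma gal_quadratic_proper : exists tau : gal_of {:L}, tau \notin H.
Proof.
apply: contrapT => noT; have : (#|'Gal({:L} / 1)%g| <= #|H|)%N.
  apply/subset_leq_card/fintype.subsetP => g _.
  by apply: contrapT => /negP Hg; apply: noT; exists g.
rewrite cardG (card_gal_quadratic galL E2 cardG) leqNgt mul2n -addnn.
by rewrite -[X in (X < _)%N]addn0 ltn_add2l prime_gt0.
Qed.

Lemma mem_unit_group_sub u : unit_group E u <-> u \in E /\ U u.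
Proof.
split=> [[[Eu Ou] [v [Ev Ov] uv]]|[Eu /unitsP[u0 [_ Ou] [_ Ou']]]].
  by split=> //; split; [split=> //; apply: memvf | exists v => //; split=> //; apply: memvf].
split; first by split.
by exists u^-1; [split=> //; rewrite memvV | rewrite divff].
Qed.

(** Since 2 and [l] are coprime, an exponent not divisible by [2 l] is odd or not divisible by [l];
    [a + b + 1] ramified primes would thus exceed one of the two bounds. *)
Lemma ramified_card_bound a b : is_polya_field {:L}%AS ->
    (forall t (p k : 'I_t -> nat) (w : 'I_t -> L), (forall i, prime (p i)) -> injective p ->
       (forall i, prime_generator l (p i) (k i) (w i)) -> (forall i, odd (k i)) -> (t <= a)%N) ->
    (forall t (p k : 'I_t -> nat) (w : 'I_t -> L), (forall i, prime (p i)) -> injective p ->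
       (forall i, prime_generator l (p i) (k i) (w i)) -> (forall i, ~~ (l %| k i)%N) ->
       (t <= b)%N) ->
  ramified_primes {:L}%AS #<= `I_(a + b).
Proof.
move=> polyaL boundA boundB; apply: card_le_II_inj => p p_inj Sp.
have pr_p i : prime (p i) by case: (Sp i).
have /choice[wk wkP] : forall i, exists wk : L * nat,
    prime_generator l (p i) wk.2 wk.1 /\ ~~ (2 * l %| wk.2)%N.
  move=> i; have [pr_pi ram_pi] := Sp i.
  have [w [k [u [w0 Uw Uu wE ndvd]]]] := ramified_generator galL polyaL pr_pi ram_pi.
  by exists (w, k); rewrite cardG in wE ndvd; split=> //; split=> //; exists u.
pose A := [set i | odd (wk i).2]%SET; pose B := [set i | ~~ (l %| (wk i).2)%N]%SET.
have AB : [set: 'I_(a + b).+1]%SET \subset (A :|: B)%SET.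
  apply/fintype.subsetP => i _; rewrite !inE -implyNb; apply/implyP => ev.
  have [_] := wkP i; apply: contra => dvd_l; rewrite Gauss_dvd ?dvdn2 ?ev //.
  by rewrite coprime2n.
have leA : (#|A| <= a)%N.
  apply: (boundA _ (fun i => p (enum_val i)) (fun i => (wk (enum_val i)).2)
                   (fun i : 'I_#|A| => (wk (enum_val i)).1)) => //.
  - by move=> i j /p_inj/enum_val_inj.
  - by move=> i; case: (wkP (enum_val i)).
  - by move=> i; have := enum_valP i; rewrite inE.
have leB : (#|B| <= b)%N.
  apply: (boundB _ (fun i => p (enum_val i)) (fun i => (wk (enum_val i)).2)
                   (fun i : 'I_#|B| => (wk (enum_val i)).1)) => //.
  - by move=> i j /p_inj/enum_val_inj.
  - by move=> i; case: (wkP (enum_val i)).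
  - by move=> i; have := enum_valP i; rewrite inE.
have := subset_leq_card AB; rewrite cardsT card_ord leqNgt => /negP[].
by rewrite ltnS (leq_trans _ (leq_add leA leB)) // -cardsUI leq_addr.
Qed.

(** * The real case: units of [E] are signed powers of [e] *)

Section Real.
Variable e : L.
Hypothesis fund_e : is_fundamental_unit E e.

Let Ue : U e. Proof. by case: fund_e => /mem_unit_group_sub[]. Qed.
Let Ee : e \in E. Proof. by case: fund_e => /mem_unit_group_sub[]. Qed.
Let e0 : e != 0 := units_neq0 Ue.

Lemma fundamental_unitP u : u \in E -> U u -> exists (s : bool) (k : int), u = (-1) ^+ s * e ^ k.
Proof.
move=> Eu Uu; case: fund_e => _ _ /(_ u)[|k [->|->]]; first exact/mem_unit_group_sub.
  by exists false, k; rewrite mul1r.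
by exists true, k; rewrite mulN1r.
Qed.

Lemma fundamental_unit_exp_inj (j k : int) : e ^ j = e ^ k -> j = k.
Proof.
suffices e1 (m : int) : e ^ m = 1 -> m = 0.
  move=> ejk; apply/eqP; rewrite -subr_eq0; apply/eqP/e1.
  by rewrite expfzDr // -invr_expz ejk divff // expfz_neq0.
case: fund_e => _ ord_e _; case: m => [[|m]|m] //.
  by move/eqP; rewrite -exprnP (negPf (ord_e _ _)).
by rewrite NegzE -exprnN => /eqP; rewrite invr_eq1 (negPf (ord_e _ _)).
Qed.

Lemma real_quadratic_torsion u : u \in E -> U u -> u ^+ l = 1 -> u = 1.
Proof.
move=> Eu Uu; have [s [k ->]] := fundamental_unitP Eu Uu => ul.
(* Squaring removes the sign, so [e ^ (2 k l) = 1]. *)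
have k0 : k = 0.
  have : e ^ ((k + k) * l%:Z) = e ^ 0.
    have -> : e ^ ((k + k) * l%:Z) = (((-1) ^+ s * e ^ k) ^+ 2) ^+ l.
      by rewrite -exprz_exp expfzDr // -exprnP [X in _ = X ^+ l]exprMn sqrr_sign mul1r expr2.
    by rewrite -exprM mulnC exprM ul expr1n expr0z.
  by move/fundamental_unit_exp_inj/eqP; rewrite mulf_eq0 eqz_nat; lia.
move: ul; rewrite k0 expr0z mulr1; case: s => //.
by rewrite expr1 -signr_odd odd_l.
Qed.

Variable tau : gal_of {:L}.
Hypothesis tauH : tau \notin H.

(** For [y = e ^ (- m)] the quotient [tau y / y] is [e ^ (2 m)] up to sign, because [e * tau e] is 1
    or -1. So only the sign and the parity of the exponent matter, which leaves four classes. *)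
Lemma real_unit_classes u : u \in E -> U u -> exists t y,
  [/\ y \in E, U y & u = (fun t : bool * bool => (-1) ^+ t.1 * e ^+ t.2) t * (tau y / y)].
Proof.
move=> Eu Uu; have [s [k uE]] := fundamental_unitP Eu Uu.
have [z [zE z1]] := quadratic_norm_unit galL E2 pr_l cardG tauH Ee Ue.
have te0 : tau e != 0 by rewrite fmorph_eq0.
have [m [d kE]] := int_parity k.
have [s' s'E] : exists s' : bool, (z%:~R : L) ^ m = (-1) ^+ s'.
  have [->|->] := absz_eq1 z1.
    by exists false; rewrite exp1rz.
  by exists (odd `|m|); rewrite signr_odd exprz_sign.
exists (s (+) s', d), (e ^ (- m)); split.
- by case: (- m) => n; rewrite ?NegzE -?exprnN ?memvV rpredX.
- exact: units_exprz.
rewrite /= uE kE expfzDr // -exprnP signr_addb -s'E -zE.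
rewrite expfzMl fmorphXz /= -!invr_expz invrK.
have -> : e ^ (m * 2) = e ^ m * e ^ m by rewrite -expfzDr //; congr (_ ^ _); ring.
have tem0 : tau e ^ m != 0 by rewrite expfz_neq0.
by move: tem0; set a := tau e ^ m; move: (e ^ m) a => b a a0; field.
Qed.

Lemma real_count_odd t (p k : 'I_t -> nat) (w : 'I_t -> L) :
  (forall i, prime (p i)) -> injective p ->
  (forall i, prime_generator l (p i) (k i) (w i)) -> (forall i, odd (k i)) -> (t <= 2)%N.
Proof.
move=> pr_p p_inj wP odd_k.
rewrite -(leq_exp2l (m := 2)) //.
have := card_odd_generators galL E2 pr_l cardG tauH _ real_unit_classes pr_p p_inj wP odd_k.
rewrite card_prod card_bool; apply => x.
by rewrite mulf_neq0 ?signr_eq0 ?expf_neq0.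
Qed.

Variable sigma : gal_of {:L}.
Hypothesis sigmaE : H = <[sigma]>%g.

Lemma real_rank t (v : 'I_t -> normOneUnits E) :
  independent_mod_diff l sigma v (norm_one_unit E) -> (t <= 2)%N.
Proof.
move=> indep; have [f] := complex_embedding_exists galL.
have sP (g : gal_of {:L}) : exists i : 'I_#|'Gal({:L} / 1)%g|,
    forall x, `|f (g x)| = `|f (enum_val i x)|.
  by exists (enum_rank_in (mem_gal1 g) g) => x; rewrite enum_rankK_in ?mem_gal1.
have := norm_one_units_rank galL E2 pr_l cardG sigmaE real_quadratic_torsion sP indep.
rewrite cardG leqNgt; apply: contraR; rewrite -ltnNge => t2.
(* Three independent units would give [3 (l - 1) <= 2 l], that is [l <= 3]. *)
apply: (@leq_trans (3 * l.-1)); last by rewrite leq_mul2r t2 orbT.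
by case: l l_gt3 => // m; lia.
Qed.

Lemma real_count_l t (p k : 'I_t -> nat) (w : 'I_t -> L) :
  (forall i, prime (p i)) -> injective p ->
  (forall i, prime_generator l (p i) (k i) (w i)) -> (forall i, ~~ (l %| k i)%N) -> (t <= 2)%N.
Proof.
move=> pr_p p_inj wP ndvd; have [v indep] :=
  generator_units_independent galL E2 pr_l cardG sigmaE tauH pr_p p_inj wP ndvd.
by apply: (@real_rank _ v) => c y /asboolP[Uy _]; apply: indep.
Qed.

(** The unit [sigma h / h] is independent of those coming from the primes, so [t + 1 <= 2]. *)
Lemma real_count_l_norm t (p k : 'I_t -> nat) (w : 'I_t -> L) :
  norm_of_units E e ->
  (forall i, prime (p i)) -> injective p ->
  (forall i, prime_generator l (p i) (k i) (w i)) -> (forall i, ~~ (l %| k i)%N) -> (t <= 1)%N.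
Proof.
case=> h Uh he pr_p p_inj wP ndvd; have [v indep] :=
  generator_units_independent galL E2 pr_l cardG sigmaE tauH pr_p p_inj wP ndvd.
have [|v' indep'] := independent_mod_diff_cons galL E2 pr_l cardG sigmaE Uh _ indep.
  (* If [e ^ c] is the [l]-th power of a signed power [e ^ m], squaring and comparing exponents
     gives [c = l * m]. *)
  move=> c q Eq Uq; have [s [m ->]] := fundamental_unitP Eq Uq.
  rewrite he => /(congr1 (fun x => x ^+ 2)).
  have -> : ((-1) ^+ s * e ^ m) ^+ l ^+ 2 = (e ^ m) ^+ (2 * l).
    by rewrite exprAC [X in X ^+ l = _]exprMn sqrr_sign mul1r -exprM.
  rewrite -exprM (exprnP e) (exprnP (e ^ m)) exprz_exp.
  move/fundamental_unit_exp_inj => /(congr1 absz); rewrite abszM !absz_nat => cm.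
  by apply/dvdnP; exists `|m|%N; apply/eqP; rewrite -(eqn_pmul2r (isT : (0 < 2)%N)) cm mulnCA mulnC.
exact: real_rank indep'.
Qed.

End Real.

(** * The imaginary case: units of [E] are roots of unity *)

Section Imaginary.
Variable f : {rmorphism L -> algC}.
Hypothesis nonreal : exists x, f x \isn't Num.real.

Variable c : gal_of {:L}.
Hypothesis cP : forall x, (f x)^* = f (c x).

(** Complex conjugation is an involution, while [H] has odd order; inside [H] it would be trivial
    and all values of [f] real. *)
Lemma conj_notin_quadratic : c \notin H.
Proof.
apply/negP => Hc; case: nonreal => x /negP[].
have c2 : (c ^+ 2 = 1)%g.
  apply/eqP/gal_eqP => y _; rewrite gal_id expgS expg1 galM ?memvf //.
  by apply: (fmorph_inj f); rewrite -!cP conjCK.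
have c1 : c = 1%g.
  apply/eqP; rewrite -order_eq1 -dvdn1.
  have /eqP <- : coprime 2 l by rewrite coprime2n.
  by rewrite dvdn_gcd order_dvdn c2 eqxx -(card_gal_quadratic galL E2 cardG) order_dvdG.
by rewrite CrealE cP c1 gal_id.
Qed.

Let cH := conj_notin_quadratic.

Lemma imaginary_unit_norm u : u \in E -> U u -> u * c u = 1 /\ `|f u| = 1.
Proof.
move=> Eu Uu; have [z [zE z1]] := quadratic_norm_unit galL E2 pr_l cardG cH Eu Uu.
have fu : `|f u| ^+ 2 = z%:~R by rewrite normCK cP -rmorphM /= zE rmorph_int.
have z_eq1 : z = 1.
  case: (absz_eq1 z1) => // zN; have := exprn_ge0 2 (normr_ge0 (f u)).
  by rewrite fu zN ler0z.
rewrite zE z_eq1; split=> //; apply/eqP.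
by rewrite -(@sqrp_eq1 _ `|f u|) // fu z_eq1.
Qed.

(** The trace [u + c u] is a rational integer bounded by 2, because [u] has absolute value 1; with
    the norm 1 it gives the quadratic equation of [u]. *)
Lemma imaginary_unit_trace u : u \in E -> U u ->
  exists z : int, (`|z| <= 2)%N /\ u ^+ 2 = z%:~R * u - 1.
Proof.
move=> Eu Uu; have [N1 f1] := imaginary_unit_norm Eu Uu.
have [r rE] : exists r, u + c u = GRing.in_alg L r.
  apply: (quadratic_fixed_rat galL E2 pr_l cardG cH).
    by rewrite rpredD // (quadratic_conj_mem galL E2 pr_l cardG cH).
  by rewrite rmorphD /= (quadratic_conjK galL E2 pr_l cardG cH) // addrC.
have [z zr] : exists z : int, r = z%:~R.
  apply: (rat_integer f); rewrite -rE; apply: integersD; first exact: units_int.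
  exact/integers_gal/units_int.
have tE : u + c u = z%:~R by rewrite rE zr rmorph_int.
exists z; split; last by rewrite -tE -N1; ring.
have : `|(z%:~R : algC)| <= 2.
  rewrite -(rmorph_int f) -tE rmorphD /= -cP.
  by apply: le_trans (ler_normD _ _) _; rewrite norm_conjC f1.
by rewrite -intr_norm -[2]/(2%:~R) ler_int; lia.
Qed.

Lemma imaginary_unit_square u : u \in E -> U u ->
  [\/ exists v, [/\ v \in E, U v & u = v ^+ 2],
      exists v, [/\ v \in E, U v & u = - v ^+ 2] | u ^+ 2 = -1].
Proof.
move=> Eu Uu; have [z [z2 uu]] := imaginary_unit_trace Eu Uu.
have [Eu2 Uu2] : u ^+ 2 \in E /\ U (u ^+ 2) by split; [apply: rpredX | apply: unitsX].
(* The traces -2, -1, 0, 1, 2 belong to [u = -1], to [u] of order 3, 4, 6, and to [u = 1]. For order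
   3, [u = u ^ 4]; for order 6, [u = - u ^ 4]. *)
have [zE|[zE|[zE|[zE|zE]]]] := small_int_cases z2; rewrite zE in uu.
- have /eqP : (u + 1) ^+ 2 = 0 by rewrite sqrrD expr1n mulr1 uu; ring.
  rewrite sqrf_eq0 addr_eq0 => /eqP ->; constructor 2.
  by exists 1; rewrite mem1v expr1n; split=> //; apply: units1.
- constructor 1; exists (u ^+ 2); split=> //.
  transitivity (u ^+ 2 + u *+ 2 + 1); first by rewrite uu; ring.
  have -> : u ^+ 2 ^+ 2 = (- u - 1) ^+ 2 by rewrite uu; ring.
  by ring.
- by constructor 3; rewrite uu; ring.
- constructor 2; exists (u ^+ 2); split=> //.
  transitivity (- (u ^+ 2 - u *+ 2 + 1)); first by rewrite uu; ring.
  have -> : u ^+ 2 ^+ 2 = (u - 1) ^+ 2 by rewrite uu; ring.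
  by ring.
have /eqP : (u - 1) ^+ 2 = 0 by rewrite sqrrB expr1n mulr1 uu; ring.
rewrite sqrf_eq0 subr_eq0 => /eqP ->; constructor 1.
by exists 1; rewrite mem1v expr1n; split=> //; apply: units1.
Qed.

Lemma imaginary_unit_exp12 u : u \in E -> U u -> u ^+ 12 = 1.
Proof.
move=> Eu Uu; have [z [z2 uu]] := imaginary_unit_trace Eu Uu.
have u12 : u ^+ 12 = (u ^+ 2) ^+ 6 by rewrite -exprM.
have u3 : u ^+ 3 = u * u ^+ 2 by rewrite exprS.
have [zE|[zE|[zE|[zE|zE]]]] := small_int_cases z2; rewrite zE in uu.
- have /eqP : (u + 1) ^+ 2 = 0 by rewrite sqrrD expr1n mulr1 uu; ring.
  by rewrite sqrf_eq0 addr_eq0 => /eqP ->; ring.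
- have u3E : u ^+ 3 = 1 by rewrite u3 uu; transitivity (- u ^+ 2 - u); [|rewrite uu]; ring.
  by rewrite (exprM u 3 4) u3E expr1n.
- by rewrite u12 uu; ring.
- have u3E : u ^+ 3 = -1 by rewrite u3 uu; transitivity (u ^+ 2 - u); [|rewrite uu]; ring.
  by rewrite (exprM u 3 4) u3E; ring.
have /eqP : (u - 1) ^+ 2 = 0 by rewrite sqrrB expr1n mulr1 uu; ring.
by rewrite sqrf_eq0 subr_eq0 => /eqP ->; ring.
Qed.

(** The order of [u] divides both 12 and [l], which are coprime for a prime [l > 3]. *)
Lemma imaginary_quadratic_torsion u : u \in E -> U u -> u ^+ l = 1 -> u = 1.
Proof.
move=> Eu Uu ul; have u12 := imaginary_unit_exp12 Eu Uu.
have co : coprime l 12.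
  rewrite (@coprimeMr l 4 3) (@coprimeXr 2 l 2) ?coprimen2 ?odd_l //.
  by rewrite prime_coprime // gtnNdvd.
have /coprimeP[|[a b] /= ab] := co; first exact: prime_gt0.
have abE : (a * l = 1 + b * 12)%N by lia.
have : u ^+ (a * l) = 1 by rewrite mulnC exprM ul expr1n.
by rewrite abE exprD [(b * 12)%N]mulnC exprM u12 expr1n mulr1 expr1.
Qed.

(** The units [c y / y] include all squares of units of [E]. The representatives are 1 and a square
    root [i] of -1 if [E] has one, since then -1 is a square; otherwise they are 1 and -1. *)
Lemma imaginary_unit_classes : exists d : bool -> L, (forall t, d t != 0) /\
  forall u, u \in E -> U u -> exists t y, [/\ y \in E, U y & u = d t * (c y / y)].
Proof.
have square v : v \in E -> U v -> c v^-1 / v^-1 = v ^+ 2.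
  move=> Ev Uv; have [N1 _] := imaginary_unit_norm Ev Uv.
  have cv0 : c v != 0 by rewrite fmorph_eq0 units_neq0.
  have -> : c v^-1 = v by rewrite fmorphV /=; apply: (mulIf cv0); rewrite mulVf.
  by rewrite invrK expr2.
have [[i [Ei i2]]|noi] := pselect (exists i, i \in E /\ i ^+ 2 = -1).
  have Ui : U i by apply: (@units_root _ _ 2) => //; rewrite i2; apply: unitsN1.
  exists (fun t : bool => if t then i else 1); split=> [[]|u Eu Uu].
  - exact: units_neq0 Ui.
  - exact: oner_neq0.
  have [[v [Ev Uv ->]]|[v [Ev Uv ->]]|u2] := imaginary_unit_square Eu Uu.
  - by exists false, v^-1; rewrite memvV mul1r square //; split=> //; apply: unitsV.
  - exists false, (i * v)^-1; rewrite memvV mul1r square ?rpredM //; last exact: unitsM.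
    by split; [|apply/unitsV/unitsM | rewrite exprMn i2 mulN1r].
  have : (u - i) * (u + i) = 0 by rewrite -subr_sqr u2 i2 subrr.
  move/eqP; rewrite mulf_eq0 subr_eq0 addr_eq0 => /orP[/eqP ->|/eqP ->].
    exists true, 1^-1; rewrite square ?mem1v ?expr1n ?mulr1 //; last exact: units1.
    by split=> //; [rewrite memvV mem1v | rewrite invr1; apply: units1].
  by exists true, i^-1; rewrite memvV square // i2 mulrN1; split=> //; apply: unitsV.
exists (fun t : bool => if t then -1 else 1); split=> [[]|u Eu Uu].
- by rewrite oppr_eq0 oner_neq0.
- exact: oner_neq0.
have [[v [Ev Uv ->]]|[v [Ev Uv ->]]|u2] := imaginary_unit_square Eu Uu.
- by exists false, v^-1; rewrite memvV mul1r square //; split=> //; apply: unitsV.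
- by exists true, v^-1; rewrite memvV mulN1r square //; split=> //; apply: unitsV.
by case: noi; exists u.
Qed.

Lemma imaginary_count_odd t (p k : 'I_t -> nat) (w : 'I_t -> L) :
  (forall i, prime (p i)) -> injective p ->
  (forall i, prime_generator l (p i) (k i) (w i)) -> (forall i, odd (k i)) -> (t <= 1)%N.
Proof.
move=> pr_p p_inj wP odd_k; have [d [d0 dP]] := imaginary_unit_classes.
rewrite -(leq_exp2l (m := 2)) // -[(2 ^ 1)%N]card_bool.
exact: (card_odd_generators galL E2 pr_l cardG cH d0 dP pr_p p_inj wP odd_k).
Qed.

Variable sigma : gal_of {:L}.
Hypothesis sigmaE : H = <[sigma]>%g.

Lemma imaginary_count_l t (p k : 'I_t -> nat) (w : 'I_t -> L) :
  (forall i, prime (p i)) -> injective p ->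
  (forall i, prime_generator l (p i) (k i) (w i)) -> (forall i, ~~ (l %| k i)%N) -> (t <= 1)%N.
Proof.
move=> pr_p p_inj wP ndvd; have [v indep] :=
  generator_units_independent galL E2 pr_l cardG sigmaE cH pr_p p_inj wP ndvd.
have indep' : independent_mod_diff l sigma v (norm_one_unit E).
  by move=> d y /asboolP[Uy _]; apply: indep.
(* An element outside [H] is one of [H] followed by complex conjugation, which preserves absolute
   values; so the [l] elements of [H] suffice. *)
have sP (g : gal_of {:L}) : exists i : 'I_#|H|, forall x, `|f (g x)| = `|f (enum_val i x)|.
  have [Hg|/(gal_coset_quadratic galL E2 pr_l cardG cH)[h Hh ->]] := boolP (g \in H).
    by exists (enum_rank_in Hg g) => x; rewrite enum_rankK_in.
  by exists (enum_rank_in Hh h) => x; rewrite enum_rankK_in // galM ?memvf // -cP norm_conjC.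
have := norm_one_units_rank galL E2 pr_l cardG sigmaE imaginary_quadratic_torsion sP indep'.
rewrite (card_gal_quadratic galL E2 cardG) leqNgt; apply: contraR; rewrite -ltnNge => t1.
(* Two independent units would give [2 (l - 1) <= l], that is [l <= 2]. *)
apply: (@leq_trans (2 * l.-1)); last by rewrite leq_mul2r t1 orbT.
by case: l l_gt3 => // m; lia.
Qed.

End Imaginary.

End CountingRamifiedPrimes.

Local Close Scope classical_set_scope.

(** * Combination of the counts: 2 + 1 or 2 + 2 in the real case, 1 + 1 in the imaginary case *)

Theorem theorem4p1 (L : splittingFieldType rat) (K E : {subfield L}) (l : nat)
    (l_prime : prime l) (l_gt3 : (3 < l)%N)
    (K_degree : \dim K = l)
    (K_not_galois : ~~ galois 1 K)
    (L_closure : is_galois_closure K {:L}%AS)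
    (gal_dihedral : ('Gal({:L} / 1) \isog [set: 'D_(2 * l)%N])%g)
    (E_quadratic : \dim E = 2%N)
    (L_polya : is_polya_field {:L}%AS) :
  (totally_real L ->
     forall e : L, is_fundamental_unit E e ->
       (norm_of_units E e -> ramified_primes {:L}%AS #<= `I_3%classic) /\
       (~ norm_of_units E e -> ramified_primes {:L}%AS #<= `I_4%classic)) /\
  (totally_complex L -> ramified_primes {:L}%AS #<= `I_2%classic).
Proof.
have galL : galois 1 {:L}%AS by case: L_closure.
have cardG : #|'Gal({:L} / 1)%g| = (2 * l)%N.
  by rewrite (card_isog gal_dihedral) mul2n card_dihedral // prime_gt1.
have [sigma sigmaE] := gal_quadratic_cyclic galL E_quadratic l_prime cardG.
split=> [_ e fund_e|complexL].
  have [tau tauH] := gal_quadratic_proper galL E_quadratic l_prime cardG.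
  split=> [norm_e|_].
    apply: (@ramified_card_bound _ _ galL l_prime l_gt3 cardG 2 1) => //.
    - exact: (real_count_odd galL E_quadratic l_prime cardG fund_e tauH).
    - move=> t p k w.
      exact: (real_count_l_norm galL E_quadratic l_prime l_gt3 cardG fund_e tauH sigmaE norm_e).
  apply: (@ramified_card_bound _ _ galL l_prime l_gt3 cardG 2 2) => //.
  - exact: (real_count_odd galL E_quadratic l_prime cardG fund_e tauH).
  - exact: (real_count_l galL E_quadratic l_prime l_gt3 cardG fund_e tauH sigmaE).
have [f] := complex_embedding_exists galL.
have [c cP] := complex_conjugation_lift galL f.
apply: (@ramified_card_bound _ _ galL l_prime l_gt3 cardG 1 1) => //.
- exact: (imaginary_count_odd galL E_quadratic l_prime l_gt3 cardG (complexL f) cP).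
- exact: (imaginary_count_l galL E_quadratic l_prime l_gt3 cardG (complexL f) cP sigmaE).
Qed.
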